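(* Let $(\mathcal H,\Delta)$ be a Hopf algebra over $\mathbb C$ with invertible antipode and $\mathcal B$ a unital right $\mathcal H$-module algebra. Suppose $X$ is a finite dimensional vector space endowed with the trivial right action $x\triangleleft\omega=\varepsilon(\omega)x$ of $\mathcal H$. Then for every $n\ge0$ the homomorphism $[\Psi^n]\colon HC^n_{\mathcal H}(\mathcal B)\to HC^n_{\mathcal H}(\mathrm{End}(X)\otimes\mathcal B)$ is an isomorphism with inverse $[\Phi_p^n]$, where $p$ is any one-dimensional idempotent in $\mathrm{End}(X)$.
   Context: All spaces are over $\mathbb C$. $\mathcal H$ has comultiplication $\Delta$, counit $\varepsilon$, invertible antipode $S$; Sweedler notation starts at $0$: $\Delta^n(\omega)=\omega_{(0)}\otimes\dots\otimes\omega_{(n)}$. A unital right $\mathcal H$-module algebra $\mathcal B$ is a unital algebra with a right $\mathcal H$-action $\triangleleft$ such that $(b_1b_2)\triangleleft\omega=(b_1\triangleleft\omega_{(0)})(b_2\triangleleft\omega_{(1)})$ and $1\triangleleft\omega=\varepsilon(\omega)1$. Equivariant cyclic cohomology: $C^n_{\mathcal H}(\mathcal B)$ is the space of linear functionals $f$ on $\mathcal H\otimes\mathcal B^{\otimes(n+1)}$ such that $f(S^{-1}(\omega_{(0)})\eta\omega_{(1)}\otimes b_0\triangleleft\omega_{(2)}\otimes\dots\otimes b_n\triangleleft\omega_{(n+2)})=\varepsilon(\omega)f(\eta\otimes b_0\otimes\dots\otimes b_n)$ for all $\omega,\eta\in\mathcal H$, $b_i\in\mathcal B$. Put $(t_nf)(\omega\otimes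 b_0\otimes\dots\otimes b_n)=f(\omega_{(0)}\otimes b_n\triangleleft\omega_{(1)}\otimes b_0\otimes\dots\otimes b_{n-1})$; $(d_i^nf)(\omega\otimes b_0\otimes\dots\otimes b_n)=f(\omega\otimes b_0\otimes\dots\otimes b_ib_{i+1}\otimes\dots\otimes b_n)$ for $0\le i<n$ ($d_i^n\colon C^{n-1}\to C^n$); $d_n^n=t_nd_0^n$; $(s_i^nf)(\omega\otimes b_0\otimes\dots\otimes b_n)=f(\omega\otimes b_0\otimes\dots\otimes b_i\otimes1\otimes b_{i+1}\otimes\dots\otimes b_n)$ ($s_i^n\colon C^{n+1}\to C^n$). This is a cocyclic vector space; $HC^\bullet_{\mathcal H}(\mathcal B)$ is its cyclic cohomology, i.e. (over $\mathbb C$) the cohomology of $(\mathrm{Ker}(\iota-\lambda),b)$ with $b_n=\sum_{i=0}^n(-1)^id_i^n$, $\lambda_n=(-1)^nt_n$. For a right $\mathcal H$-module $X$ let $\pi_X(\omega)x=x\triangleleft\omega$. $\mathrm{End}(X)\otimes\mathcal B$ is a unital right $\mathcal H$-module algebra via $(T\otimes b)\blacktriangleleft\omega=\pi_X(\omega_{(0)})T\pi_X(S^{-1}(\omega_{(2)}))\otimes b\triangleleft\omega_{(1)}$ (for the trivial action on $X$ this is $T\otimes b\triangleleft\omega$). For $X$ finite dimensional, $\Psi^n\colon C^n_{\mathcal H}(\mathcal B)\to C^n_{\mathcal H}(\mathrm{End}(X)\otimes\mathcal B)$ is $$(\Psi^nf)(\omega\otimes(T_0\otimes b_0)\otimes\dots\otimes(T_n\otimes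 b_n))=f(\omega_{(0)}\otimes b_0\otimes\dots\otimes b_n)\,\mathrm{Tr}(\pi_X(S^{-1}(\omega_{(1)}))T_0\cdots T_n),$$ a morphism of cocyclic objects inducing $[\Psi^n]$ on $HC^n$. For $p$ as in the claim, $\Phi_p\colon\mathcal B\to\mathrm{End}(X)\otimes\mathcal B$, $\Phi_p(b)=p\otimes b$, is an algebra homomorphism respecting the $\mathcal H$-actions, and $[\Phi_p^n]\colon HC^n_{\mathcal H}(\mathrm{End}(X)\otimes\mathcal B)\to HC^n_{\mathcal H}(\mathcal B)$ is induced by $f\mapsto f\circ(\iota\otimes\Phi_p^{\otimes(n+1)})$. A one-dimensional idempotent is one of rank one. *)

(* Defs.v *)
From HB Require Import structures.
From mathcomp Require Import all_boot all_order all_algebra.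
From mathcomp Require Import boolp functions reals complex zify.

Set Implicit Arguments.
Unset Strict Implicit.
Unset Printing Implicit Defensive.

Import Order.TTheory GRing.Theory Num.Theory.
Local Open Scope ring_scope.
Local Open Scope quotient_scope.

Reserved Notation "u \ox v" (at level 40, left associativity).

Definition bilin (K : fieldType) (U V W : lmodType K) (beta : U -> V -> W) :=
  (forall v, linear (beta^~ v)) /\ (forall u, linear (beta u)).

(* MathComp's algType excludes the zero algebra, which is allowed here.       *)
HB.mixin Record Lmodule_isUnitalAlgebra (K : fieldType) A
    of GRing.Lmodule K A := {
  umul : A -> A -> A;
  uone : A;
  umulA : associative umul;
  umul1l : left_id uone umul;
  umul1r : right_id uone umul;
  umul_bilin : bilin umul
}.

#[short(type="unitalAlgType")]
HB.structure Definition UnitalAlgebra (K : fieldType) :=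
  {A of GRing.Lmodule K A & Lmodule_isUnitalAlgebra K A}.

Notation "x ** y" := (umul x y) (at level 40, left associativity) : ring_scope.

Section TensorDef.
Variables (K : fieldType) (U V : lmodType K).

Definition fsum (W : nmodType) (beta : U -> V -> W) (s : seq (U * V)) : W :=
  \sum_(p <- s) beta p.1 p.2.

(* A finite list of pairs (u_i, v_i) stands for the sum of the u_i (x) v_i;   *)
(* two lists are identified when no bilinear map separates them.              *)
Definition fsum_eqv (s t : seq (U * V)) : bool :=
  `[< forall (W : lmodType K) (beta : U -> V -> W), bilin beta ->
        fsum beta s = fsum beta t >].

Lemma fsum_eqv_equiv : equiv_class_of fsum_eqv.
Proof.
split=> [s|s t|t s r].
- by apply/asboolP.
- by apply/asboolP/asboolP=> h W beta hb; rewrite h.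
- move=> /asboolP h1 /asboolP h2; apply/asboolP=> W beta hb.
  by rewrite h1 // h2.
Qed.

Canonical fsum_eqv_equiv_rel := EquivRelPack fsum_eqv_equiv.
Canonical fsum_eqv_encModRel := defaultEncModRel fsum_eqv.

Definition tensor := {eq_quot fsum_eqv}.
HB.instance Definition _ := EqQuotient.on tensor.
HB.instance Definition _ := Choice.on tensor.

Definition tpair (u : U) (v : V) : tensor := \pi_tensor [:: (u, v)].

(* For bilinear beta, this is the linear map sending u \ox v to beta u v; the *)
(* chosen representative of t is then irrelevant.                             *)
Definition tlift (W : nmodType) (beta : U -> V -> W) (t : tensor) : W :=
  fsum beta (repr t).

Lemma tlift_pi (W : lmodType K) (beta : U -> V -> W) s : bilin beta ->
  tlift beta (\pi_tensor s) = fsum beta s.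
Proof.
move=> hb; have /eqmodP/asboolP h : repr (\pi_tensor s) = s %[mod tensor].
  by rewrite reprK.
exact: h.
Qed.

Lemma tensor_extP (x y : tensor) :
  (forall (W : lmodType K) (beta : U -> V -> W), bilin beta ->
     tlift beta x = tlift beta y) -> x = y.
Proof.
move=> h; rewrite -[x]reprK -[y]reprK; apply/eqmodP/asboolP=> W beta hb.
exact: h.
Qed.

Definition tzero : tensor := \pi_tensor [::].
Definition tadd (x y : tensor) : tensor := \pi_tensor (repr x ++ repr y).
Definition tscale (a : K) (x : tensor) : tensor :=
  \pi_tensor [seq (a *: p.1, p.2) | p <- repr x].
Definition topp (x : tensor) : tensor := tscale (-1) x.

Section Tlift.
Variables (W : lmodType K) (beta : U -> V -> W).
Hypothesis hb : bilin beta.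

Lemma bilinDl u u' v : beta (u + u') v = beta u v + beta u' v.
Proof. by have := hb.1 v 1 u u'; rewrite !scale1r. Qed.
Lemma bilinDr u v v' : beta u (v + v') = beta u v + beta u v'.
Proof. by have := hb.2 u 1 v v'; rewrite !scale1r. Qed.
Lemma bilin0l v : beta 0 v = 0.
Proof. by apply: (addrI (beta 0 v)); rewrite -bilinDl !addr0. Qed.
Lemma bilin0r u : beta u 0 = 0.
Proof. by apply: (addrI (beta u 0)); rewrite -bilinDr !addr0. Qed.
Lemma bilinZl a u v : beta (a *: u) v = a *: beta u v.
Proof. by have := hb.1 v a u 0; rewrite /= !addr0 bilin0l addr0. Qed.
Lemma bilinZr a u v : beta u (a *: v) = a *: beta u v.
Proof. by have := hb.2 u a v 0; rewrite !addr0 bilin0r addr0. Qed.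

Lemma tlift_tzero : tlift beta tzero = 0.
Proof. by rewrite tlift_pi // /fsum big_nil. Qed.
Lemma tlift_tadd x y : tlift beta (tadd x y) = tlift beta x + tlift beta y.
Proof. by rewrite tlift_pi // /fsum big_cat. Qed.
Lemma tlift_tscale a x : tlift beta (tscale a x) = a *: tlift beta x.
Proof.
rewrite tlift_pi // /fsum big_map scaler_sumr.
by apply: eq_bigr=> p _; rewrite bilinZl.
Qed.
End Tlift.

Lemma taddA : associative tadd.
Proof. by move=> x y z; apply: tensor_extP=> W b hb; rewrite !tlift_tadd // addrA. Qed.
Lemma taddC : commutative tadd.
Proof. by move=> x y; apply: tensor_extP=> W b hb; rewrite !tlift_tadd // addrC. Qed.
Lemma tadd0 : left_id tzero tadd.
Proof.
by move=> x; apply: tensor_extP=> W b hb; rewrite tlift_tadd // tlift_tzero // add0r.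
Qed.
Lemma taddN : left_inverse tzero topp tadd.
Proof.
move=> x; apply: tensor_extP=> W b hb.
by rewrite tlift_tadd // tlift_tscale // tlift_tzero // scaleN1r addNr.
Qed.

HB.instance Definition _ := GRing.isZmodule.Build tensor taddA taddC tadd0 taddN.

Lemma tscaleA a b x : tscale a (tscale b x) = tscale (a * b) x.
Proof. by apply: tensor_extP=> W f hf; rewrite !tlift_tscale // scalerA. Qed.
Lemma tscale1 : left_id 1 tscale.
Proof. by move=> x; apply: tensor_extP=> W f hf; rewrite !tlift_tscale // scale1r. Qed.
Lemma tscaleDr : right_distributive tscale +%R.
Proof.
move=> a x y; apply: tensor_extP=> W f hf.
by rewrite !(tlift_tadd, tlift_tscale) // scalerDr.
Qed.
Lemma tscaleDl x : {morph tscale^~ x : a b / a + b}.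
Proof.
move=> a b; apply: tensor_extP=> W f hf.
by rewrite !(tlift_tadd, tlift_tscale) // scalerDl.
Qed.

HB.instance Definition _ := GRing.Zmodule_isLmodule.Build K tensor
  tscaleA tscale1 tscaleDr tscaleDl.

Lemma tlift_linear (W : lmodType K) (beta : U -> V -> W) : bilin beta ->
  linear (tlift beta).
Proof. by move=> hb a x y; rewrite tlift_tadd // tlift_tscale. Qed.

Lemma tlift_tpair (W : lmodType K) (beta : U -> V -> W) u v : bilin beta ->
  tlift beta (tpair u v) = beta u v.
Proof. by move=> hb; rewrite tlift_pi // /fsum big_seq1. Qed.

Lemma tpair_bilin : bilin tpair.
Proof.
split=> [v a u u'|u a v v']; apply: tensor_extP=> W f hf;
  rewrite (tlift_linear hf) !tlift_tpair //.
- exact: hf.1.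
- exact: hf.2.
Qed.

Lemma tensorE (x : tensor) : x = \sum_(p <- repr x) tpair p.1 p.2.
Proof.
apply: tensor_extP=> W f hf; rewrite {1}/tlift /fsum.
elim: (repr x)=> [|p s IH]; first by rewrite !big_nil tlift_tzero.
by rewrite !big_cons tlift_tadd // tlift_tpair // IH.
Qed.

Lemma tensor_eq_linear (W : lmodType K) (f g : tensor -> W) :
  linear f -> linear g -> (forall u v, f (tpair u v) = g (tpair u v)) -> f =1 g.
Proof.
move=> lf lg h x; rewrite (tensorE x).
pose F := HB.pack_for {linear tensor -> W} f (GRing.isLinear.Build _ _ _ _ f lf).
pose G := HB.pack_for {linear tensor -> W} g (GRing.isLinear.Build _ _ _ _ g lg).
rewrite -[f]/(F : _ -> _) -[g]/(G : _ -> _) !linear_sum.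
by apply: eq_bigr=> p _; rewrite /F /G /= h.
Qed.

End TensorDef.

Notation "u \ox v" := (tpair u v) : ring_scope.

Section LinearLemmas.
Variable K : fieldType.
Implicit Types U V W : lmodType K.

Lemma linear_bigsum V W (I : Type) (s : seq I) (F : I -> V -> W) :
  (forall i, linear (F i)) -> linear (fun x => \sum_(i <- s) F i x).
Proof.
move=> hF a x y; elim: s => [|i s IH]; first by rewrite !big_nil scaler0 addr0.
by rewrite !big_cons IH hF scalerDr addrACA.
Qed.

Lemma lin_sum V W (f : V -> W) : linear f ->
  forall (I : Type) (s : seq I) (F : I -> V),
  f (\sum_(i <- s) F i) = \sum_(i <- s) f (F i).
Proof.
move=> lf I s F; have f0 : f 0 = 0.
  have := lf 1 0 0; rewrite !scale1r !addr0 => h.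
  by apply: (addrI (f 0)); rewrite addr0.
elim: s => [|i s IH]; first by rewrite !big_nil.
by rewrite !big_cons -IH -[X in f (X + _)]scale1r lf scale1r.
Qed.

Lemma lin_scale V W (f : V -> W) : linear f -> forall a x, f (a *: x) = a *: f x.
Proof.
move=> lf a x; have f0 : f 0 = 0 by have := lin_sum lf [::] (fun _ : unit => 0); rewrite !big_nil.
by have := lf a x 0; rewrite f0 !addr0.
Qed.

Lemma lin_comp U V W (g : V -> W) (f : U -> V) :
  linear g -> linear f -> linear (fun x => g (f x)).
Proof. by move=> lg lf a x y; rewrite lf lg. Qed.

Lemma tlift_param U V W W' (beta : W' -> U -> V -> W) (t : tensor U V) :
  (forall u v, linear (fun x => beta x u v)) -> linear (fun x => tlift (beta x) t).
Proof. by move=> h; apply: linear_bigsum=> p; apply: h. Qed.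

Lemma lin_tlift U V W W' (g : W -> W') (beta : U -> V -> W) (t : tensor U V) :
  linear g -> g (tlift beta t) = tlift (fun u v => g (beta u v)) t.
Proof. by move=> lg; rewrite /tlift /fsum lin_sum. Qed.

Lemma eq_tlift U V W (b b' : U -> V -> W) (t : tensor U V) :
  (forall u v, b u v = b' u v) -> tlift b t = tlift b' t.
Proof. by move=> h; apply: eq_bigr. Qed.
End LinearLemmas.

Section TensorAlgebra.
Variables (K : fieldType) (A B : unitalAlgType K).

Definition tmul (x y : tensor A B) : tensor A B :=
  tlift (fun a b => tlift (fun a' b' => (a ** a') \ox (b ** b')) y) x.
Definition tone : tensor A B := uone \ox uone.

Let bil2 (a : A) (b : B) : bilin (fun a' b' => (a ** a') \ox (b ** b')).
Proof.
split=> [v c u u'|u c v v'] /=.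
  by rewrite (umul_bilin.2 a) (tpair_bilin _ _).1.
by rewrite (umul_bilin.2 b) (tpair_bilin _ _).2.
Qed.

Let bil1 (y : tensor A B) :
  bilin (fun a b => tlift (fun a' b' => (a ** a') \ox (b ** b')) y).
Proof.
split=> [v|u]; apply: tlift_param => a' b' c x x'.
  by rewrite (umul_bilin.1 a') (tpair_bilin _ _).1.
by rewrite (umul_bilin.1 b') (tpair_bilin _ _).2.
Qed.

Lemma tmul_bilin : bilin tmul.
Proof.
split=> [y|x]; first exact: tlift_linear (bil1 y).
by apply: tlift_param => a b; apply: tlift_linear.
Qed.

Lemma tmul_pair a b a' b' : tmul (a \ox b) (a' \ox b') = (a ** a') \ox (b ** b').
Proof.
rewrite /tmul tlift_tpair; last exact: bil1.
by rewrite tlift_tpair.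
Qed.

Lemma tmulA : associative tmul.
Proof.
move=> x y z; move: x; apply: tensor_eq_linear.
- exact: tmul_bilin.1.
- by apply: (lin_comp (tmul_bilin.1 z)); apply: tmul_bilin.1.
move=> a b; move: y; apply: tensor_eq_linear.
- by apply: (lin_comp (tmul_bilin.2 _)); apply: tmul_bilin.1.
- by apply: (lin_comp (tmul_bilin.1 z)); apply: tmul_bilin.2.
move=> a' b'; move: z; apply: tensor_eq_linear.
- by apply: (lin_comp (tmul_bilin.2 _)); apply: tmul_bilin.2.
- exact: tmul_bilin.2.
by move=> a'' b''; rewrite !tmul_pair !umulA.
Qed.

Lemma tmul1l : left_id tone tmul.
Proof.
apply: tensor_eq_linear; [exact: tmul_bilin.2 | by move=> ? ? ? | move=> a b].
by rewrite tmul_pair !umul1l.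
Qed.

Lemma tmul1r : right_id tone tmul.
Proof.
apply: tensor_eq_linear; [exact: tmul_bilin.1 | by move=> ? ? ? | move=> a b].
by rewrite tmul_pair !umul1r.
Qed.

HB.instance Definition _ := Lmodule_isUnitalAlgebra.Build K (tensor A B)
  tmulA tmul1l tmul1r tmul_bilin.

End TensorAlgebra.

(* Hopf algebras with an invertible antipode, of inverse antipodeV.           *)
Record hopfAlgebra (K : fieldType) (H : unitalAlgType K) := HopfAlgebra {
  comul : {linear H -> tensor H H};
  counit : {scalar H};
  antipode : {linear H -> H};
  antipodeV : H -> H;
  comul1 : comul uone = uone;
  comulM : forall x y, comul (x ** y) = comul x ** comul y;
  counit1 : counit uone = 1;
  counitM : forall x y, counit (x ** y) = counit x * counit y;
  (* (Delta (x) id) Delta = (id (x) Delta) Delta *)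
  coassoc : forall x,
    tlift (fun a b => tlift (fun a' a'' => a' \ox (a'' \ox b)) (comul a)) (comul x)
    = tlift (fun a b => tlift (fun b' b'' => a \ox (b' \ox b'')) (comul b)) (comul x);
  counitl : forall x, tlift (fun a b => counit a *: b) (comul x) = x;
  counitr : forall x, tlift (fun a b => counit b *: a) (comul x) = x;
  antipodel : forall x,
    tlift (fun a b => antipode a ** b) (comul x) = counit x *: (uone : H);
  antipoder : forall x,
    tlift (fun a b => a ** antipode b) (comul x) = counit x *: (uone : H);
  antipodeK : cancel antipode antipodeV;
  antipodeVK : cancel antipodeV antipode
}.

Section EndAlgebra.
Variables (K : fieldType) (X : vectType K).

Definition endo := 'End(X).
HB.instance Definition _ := GRing.Lmodule.on endo.

Definition endo_mul (S T : endo) : endo := (S \o T)%VF.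
Definition endo_one : endo := \1%VF.

Lemma endo_mul_bilin : bilin endo_mul.
Proof.
split=> [T a S S'|S a T T'].
  by rewrite /endo_mul comp_lfunDl comp_lfunZl.
by rewrite /endo_mul comp_lfunDr comp_lfunZr.
Qed.

HB.instance Definition _ := Lmodule_isUnitalAlgebra.Build K endo
  (@comp_lfunA _ _ _ _ _) (@comp_lfun1l _ _ _) (@comp_lfun1r _ _ _) endo_mul_bilin.

Definition trace (T : endo) : K^o :=
  \tr (passmx.mxof (vbasis {:X}) (vbasis {:X}) T).

End EndAlgebra.

Section Modules.
Variables (K : fieldType) (H : unitalAlgType K) (hH : hopfAlgebra H).

(* The sum of the w_0 (x) ... (x) w_n, for w = [:: w_0; ...; w_n] in          *)
(* sweedler n x, is the iterated comultiplication of x. Only sums that are    *)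
(* multilinear in the entries w`_i are taken over this list, so they do not   *)
(* depend on the representatives chosen.                                      *)
Fixpoint sweedler (n : nat) (x : H) : seq (seq H) :=
  if n is m.+1 then
    [seq p.1 :: l | p <- repr (comul hH x), l <- sweedler m p.2]
  else [:: [:: x]].

(* pi x is the operator v |-> v <| x, so pi reverses products.                *)
Record rightModule (X : vectType K) := RightModule {
  pi_mod :> H -> endo X;
  pi_mod_linear : linear pi_mod;
  pi_mod1 : pi_mod uone = uone;
  pi_modM : forall x y, pi_mod (x ** y) = pi_mod y ** pi_mod x
}.

Record moduleAlgebra (B : unitalAlgType K) := ModuleAlgebra {
  mact :> B -> H -> B;
  mact_bilin : bilin mact;
  mact1 : forall b, mact b uone = b;
  mactM : forall b x y, mact b (x ** y) = mact (mact b x) y;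
  mact_mul : forall b c x,
    mact (b ** c) x = \sum_(w <- sweedler 1 x) mact b w`_0 ** mact c w`_1;
  mact_one : forall x, mact uone x = counit hH x *: (uone : B)
}.

Lemma triv_pi_linear X : linear (fun x => counit hH x *: (uone : endo X)).
Proof. by move=> a x y; rewrite linearP /= scalerDl scalerA. Qed.
Lemma triv_pi1 X : counit hH uone *: (uone : endo X) = uone.
Proof. by rewrite counit1 scale1r. Qed.
Lemma triv_piM X x y : counit hH (x ** y) *: (uone : endo X)
  = (counit hH y *: (uone : endo X)) ** (counit hH x *: (uone : endo X)).
Proof.
have [bl br] := (@umul_bilin _ (endo X)).
by rewrite (lin_scale (bl _)) (lin_scale (br _)) umul1l scalerA counitM mulrC.
Qed.

Definition trivModule (X : vectType K) : rightModule X :=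
  RightModule (triv_pi_linear X) (triv_pi1 X) (triv_piM X).

(* The action (T \ox b) <| x =                                                *)
(*   pi(x_(0)) T pi(S^-1(x_(2))) \ox b <| x_(1) on End(X) (x) B.              *)
Definition endT_act (X : vectType K) (pi : rightModule X) (B : unitalAlgType K)
    (act : moduleAlgebra B) (t : tensor (endo X) B) (x : H) : tensor (endo X) B :=
  tlift (fun T b => \sum_(w <- sweedler 2 x)
     (pi w`_0 ** T ** pi (antipodeV hH w`_2)) \ox act b w`_1) t.

Lemma sum_sweedlerS (W : lmodType K) n x (F : seq H -> W) :
  \sum_(w <- sweedler n.+1 x) F w =
  tlift (fun a b => \sum_(w <- sweedler n b) F (a :: w)) (comul hH x).
Proof. by rewrite /= big_allpairs_dep. Qed.

Lemma sum_sweedler0 (W : lmodType K) x (F : seq H -> W) :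
  \sum_(w <- sweedler 0 x) F w = F [:: x].
Proof. by rewrite big_seq1. Qed.

Lemma sum_sweedler1 (W : lmodType K) x (F : H -> H -> W) :
  \sum_(w <- sweedler 1 x) F w`_0 w`_1 = tlift F (comul hH x).
Proof. by rewrite sum_sweedlerS; apply: eq_tlift=> a b; rewrite sum_sweedler0. Qed.

Lemma lin_counitr (W : lmodType K) (g : H -> W) x : linear g ->
  tlift (fun a b => counit hH b *: g a) (comul hH x) = g x.
Proof.
move=> lg; rewrite -[in RHS](counitr hH x) (lin_tlift _ _ lg).
by apply: eq_tlift=> a b; rewrite (lin_scale lg).
Qed.

Lemma lin_counitl (W : lmodType K) (g : H -> W) x : linear g ->
  tlift (fun a b => counit hH a *: g b) (comul hH x) = g x.
Proof.
move=> lg; rewrite -[in RHS](counitl hH x) (lin_tlift _ _ lg).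
by apply: eq_tlift=> a b; rewrite (lin_scale lg).
Qed.

Lemma counit_antipode x : counit hH (antipode hH x) = counit hH x.
Proof.
have le : linear (counit hH : H -> K^o) := fun a u v => linearP (counit hH) a u v.
have la : linear (antipode hH) := fun a u v => linearP _ a u v.
rewrite -(lin_counitr x (lin_comp le la)).
transitivity (counit hH (tlift (fun a b => antipode hH a ** b) (comul hH x))).
  rewrite (lin_tlift _ _ le); apply: eq_bigr=> p _.
  by rewrite counitM mulrC.
by rewrite antipodel linearZ /= counit1 mulr1.
Qed.

Lemma counit_antipodeV x : counit hH (antipodeV hH x) = counit hH x.
Proof. by rewrite -counit_antipode antipodeVK. Qed.

Section EndTriv.
Variables (X : vectType K) (B : unitalAlgType K) (act : moduleAlgebra B).
Local Notation E := (tensor (endo X) B).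
Local Notation eact := (@endT_act X (trivModule X) B act).

Lemma act_linr b : linear (act b). Proof. exact: (mact_bilin act).2. Qed.
Lemma act_linl x : linear (act^~ x). Proof. exact: (mact_bilin act).1. Qed.

Let term_triv (T : endo X) b x :
  \sum_(w <- sweedler 2 x)
    (trivModule X w`_0 ** T ** trivModule X (antipodeV hH w`_2)) \ox act b w`_1
  = T \ox act b x.
Proof.
have [bl br] := (@umul_bilin _ (endo X)).
have [tl tr] := (@tpair_bilin _ (endo X) B).
transitivity (\sum_(w <- sweedler 2 x)
   counit hH w`_0 *: (counit hH w`_2 *: (T \ox act b w`_1))).
  apply: eq_bigr=> w _ /=.
  rewrite counit_antipodeV (lin_scale (bl _)) (lin_scale (bl _)).
  rewrite (lin_scale (br _)) umul1l umul1r scalerA.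
  by rewrite (lin_scale (tl _)) scalerA.
have lg : linear (fun y => T \ox act b y) := lin_comp (tr T) (act_linr b).
rewrite sum_sweedlerS -[RHS](lin_counitl x lg); apply: eq_tlift=> a c /=.
rewrite -scaler_sumr; congr (_ *: _).
by rewrite (sum_sweedler1 c (fun y z => counit hH z *: (T \ox act b y)))
           (lin_counitr _ lg).
Qed.

Lemma endT_trivE t x : eact t x = tlift (fun T b => T \ox act b x) t.
Proof. by apply: eq_tlift=> T b; apply: term_triv. Qed.

Lemma endT_bil x : bilin (fun (T : endo X) b => T \ox act b x).
Proof.
have [tl tr] := (@tpair_bilin _ (endo X) B).
split=> [b|T]; first exact: tl.
exact: lin_comp (tr T) (act_linl x).
Qed.

Lemma endT_pair T b x : eact (T \ox b) x = T \ox act b x.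
Proof. by rewrite endT_trivE tlift_tpair //; apply: endT_bil. Qed.

Lemma endT_act_bilin : bilin eact.
Proof.
split=> [x a t t'|t a x y].
  rewrite /= !endT_trivE; exact: (tlift_linear (endT_bil x)).
rewrite !endT_trivE; apply: (tlift_param (W' := H)
  (beta := fun x (T : endo X) b => T \ox act b x)).
by move=> T b; apply: (lin_comp ((tpair_bilin _ _).2 T) (act_linr b)).
Qed.

Lemma endT_act1 t : eact t uone = t.
Proof.
rewrite endT_trivE [RHS]tensorE; apply: eq_bigr=> p _.
by rewrite mact1.
Qed.

Lemma endT_actM t x y : eact t (x ** y) = eact (eact t x) y.
Proof.
move: t; apply: tensor_eq_linear.
- exact: endT_act_bilin.1.
- exact: lin_comp (endT_act_bilin.1 y) (endT_act_bilin.1 x).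
by move=> T b; rewrite !endT_pair mactM.
Qed.

Lemma endT_act_mul s t x :
  eact (s ** t) x = \sum_(w <- sweedler 1 x) eact s w`_0 ** eact t w`_1.
Proof.
have [ml mr] := (@umul_bilin _ E).
move: s; apply: tensor_eq_linear.
- exact: lin_comp (endT_act_bilin.1 x) (ml t).
- by apply: linear_bigsum=> w; apply: lin_comp (ml _) (endT_act_bilin.1 _).
move=> T b; move: t; apply: tensor_eq_linear.
- exact: lin_comp (endT_act_bilin.1 x) (mr _).
- by apply: linear_bigsum=> w; apply: lin_comp (mr _) (endT_act_bilin.1 _).
move=> T' b'.
have -> : (T \ox b) ** (T' \ox b') = (T ** T') \ox (b ** b') by apply: tmul_pair.
rewrite endT_pair mact_mul (lin_sum ((@tpair_bilin _ _ _).2 _)).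
apply: eq_bigr=> w _; rewrite !endT_pair; symmetry; exact: tmul_pair.
Qed.

Lemma endT_act_one x : eact uone x = counit hH x *: (uone : E).
Proof.
rewrite [uone in LHS]/(uone \ox uone) endT_pair mact_one.
by rewrite (lin_scale ((@tpair_bilin _ _ _).2 _)).
Qed.

Definition endT_trivial : moduleAlgebra E :=
  ModuleAlgebra endT_act_bilin endT_act1 endT_actM endT_act_mul endT_act_one.

End EndTriv.
End Modules.

Section Subquotient.
Variables (K : fieldType) (V : lmodType K) (Z B : submodClosed V).

Record subsp := Subsp { subsp_val : V; _ : (Z : {pred V}) subsp_val }.
HB.instance Definition _ := [isSub of subsp for subsp_val].
HB.instance Definition _ := [Choice of subsp by <:].
HB.instance Definition _ :=
  GRing.SubChoice_isSubLmodule.Build K V (Z : {pred V}) subsp (submodClosedP Z).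

Definition subB : {pred subsp} := fun z => val z \in B.

Lemma subB_closed : submod_closed subB.
Proof.
split=> [|a x y hx hy]; rewrite unfold_in /subB /=; first exact: rpred0.
by rewrite rpredD // rpredZ.
Qed.
HB.instance Definition _ := GRing.isSubmodClosed.Build K subsp subB subB_closed.

(* The subquotient Z / (Z :&: B).                                             *)
Definition subquot := Quotient.quot subB.
HB.instance Definition _ := GRing.Zmodule.on subquot.

Definition subq_class (z : subsp) : subquot := \pi_(Quotient.quot subB) z.

Lemma subq_class_eq (x y : subsp) :
  subq_class x = subq_class y <-> val x - val y \in B.
Proof.
rewrite (_ : (val x - val y \in B) = (x - y \in subB)) //.
by rewrite Quotient.idealrBE; split=> [h|/eqP //]; apply/eqP.
Qed.

Lemma subq_classD x y : subq_class (x + y) = subq_class x + subq_class y.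
Proof. exact: (raddfD (\pi_(Quotient.quot subB))). Qed.

Definition subq_scale (a : K) (q : subquot) : subquot := subq_class (a *: repr q).

Lemma subq_reprK (q : subquot) : subq_class (repr q) = q.
Proof. exact: (@reprK _ (Quotient.quot subB)). Qed.

Lemma subq_scale_class a z : subq_scale a (subq_class z) = subq_class (a *: z).
Proof.
apply/subq_class_eq.
have -> : val (a *: repr (subq_class z)) - val (a *: z)
          = a *: (val (repr (subq_class z)) - val z) by rewrite scalerBr.
by rewrite rpredZ //; apply/subq_class_eq; rewrite subq_reprK.
Qed.

Lemma subq_ind (P : subquot -> Prop) : (forall z, P (subq_class z)) -> forall q, P q.
Proof. by move=> h q; rewrite -(subq_reprK q). Qed.

Lemma subq_scaleA a b q : subq_scale a (subq_scale b q) = subq_scale (a * b) q.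
Proof. by elim/subq_ind: q => z; rewrite !subq_scale_class scalerA. Qed.
Lemma subq_scale1 : left_id 1 subq_scale.
Proof. by elim/subq_ind=> z; rewrite !subq_scale_class scale1r. Qed.
Lemma subq_scaleDr : right_distributive subq_scale +%R.
Proof.
move=> a; elim/subq_ind=> x; elim/subq_ind=> y.
by rewrite -subq_classD !subq_scale_class scalerDr subq_classD.
Qed.
Lemma subq_scaleDl q : {morph subq_scale^~ q : a b / a + b}.
Proof.
by elim/subq_ind: q => x a b; rewrite !subq_scale_class scalerDl subq_classD.
Qed.
HB.instance Definition _ := GRing.Zmodule_isLmodule.Build K subquot
  subq_scaleA subq_scale1 subq_scaleDr subq_scaleDl.

Lemma subq_class_linear : linear subq_class.
Proof. by move=> a x y; rewrite subq_classD -subq_scale_class. Qed.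
End Subquotient.

Section Induced.
Variables (K : fieldType) (V V' : lmodType K).
Variables (Z B : submodClosed V) (Z' B' : submodClosed V').
Variable phi : V -> V'.
Hypothesis phi_lin : linear phi.
Hypothesis phiZ : forall x, x \in Z -> phi x \in Z'.
Hypothesis phiB : forall x, x \in B -> phi x \in B'.

Definition subsp_map (z : subsp Z) : subsp Z' := Subsp (phiZ (valP z)).

Definition induced_fun (q : subquot Z B) : subquot Z' B' :=
  subq_class B' (subsp_map (repr q)).

Lemma induced_fun_class z :
  induced_fun (subq_class B z) = subq_class B' (subsp_map z).
Proof.
apply/subq_class_eq => /=.
rewrite -scaleN1r addrC -phi_lin; apply: phiB.
rewrite scaleN1r addrC; apply/subq_class_eq; exact: subq_reprK.
Qed.

Lemma induced_linear : linear induced_fun.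
Proof.
move=> a; elim/subq_ind=> x; elim/subq_ind=> y.
rewrite -subq_class_linear !induced_fun_class -subq_class_linear.
by congr (subq_class _ _); apply: val_inj => /=; apply: phi_lin.
Qed.

Definition induced : {linear subquot Z B -> subquot Z' B'} :=
  HB.pack_for {linear subquot Z B -> subquot Z' B'} induced_fun
    (GRing.isLinear.Build K (subquot Z B) (subquot Z' B') _ induced_fun
       induced_linear).

Lemma induced_class z : induced (subq_class B z) = subq_class B' (subsp_map z).
Proof. exact: induced_fun_class. Qed.
End Induced.

(* Below, b : 'I_n -> V stands for the family (b_0, ..., b_(n-1)).            *)
Definition upd (V : Type) n (b : 'I_n -> V) (i : 'I_n) (x : V) : 'I_n -> V :=
  fun j => if j == i then x else b j.

Definition multilinear (K : fieldType) (V W : lmodType K) n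
    (F : ('I_n -> V) -> W) :=
  forall b i, linear (fun x => F (upd b i x)).

Definition fcons (V : Type) n (u : V) (us : 'I_n -> V) : 'I_n.+1 -> V :=
  fun i => if unlift ord0 i is Some j then us j else u.

Section Mlift.
Variables (K : fieldType) (U V : lmodType K).

(* For G linear in each of its arguments, the multilinear map sending         *)
(* (u_0 \ox v_0, ..., u_(m-1) \ox v_(m-1)) to G u v.                          *)
Fixpoint mlift (W : nmodType) m :
    (('I_m -> U) -> ('I_m -> V) -> W) -> ('I_m -> tensor U V) -> W :=
  match m with
  | 0 => fun G _ => G (fun=> 0) (fun=> 0)
  | m'.+1 => fun G x =>
      tlift (fun u v => mlift (fun us vs => G (fcons u us) (fcons v vs))
                          (fun i => x (lift ord0 i))) (x ord0)
  end.

Lemma fcons0 (T : Type) n (u : T) (us : 'I_n -> T) : fcons u us ord0 = u.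
Proof. by rewrite /fcons unlift_none. Qed.
Lemma fconsS (T : Type) n (u : T) (us : 'I_n -> T) i : fcons u us (lift ord0 i) = us i.
Proof. by rewrite /fcons liftK. Qed.
Lemma fcons_eta (T : Type) n (x : 'I_n.+1 -> T) :
  fcons (x ord0) (fun i => x (lift ord0 i)) = x.
Proof. by apply/funext=> i; rewrite /fcons; case: unliftP => [j|] ->. Qed.
Lemma fcons_with0 (T : Type) n (u v : T) (us : 'I_n -> T) :
  upd (fcons u us) (ord0) v = fcons v us.
Proof.
apply/funext=> i; rewrite /upd /fcons; case: unliftP => [j|] ->; last by rewrite eqxx.
by rewrite eq_sym (negbTE (neq_lift _ _)).
Qed.
Lemma fcons_withS (T : Type) n (u v : T) (us : 'I_n -> T) i :
  upd (fcons u us) (lift ord0 i) v = fcons u (upd us i v).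
Proof.
apply/funext=> j; rewrite /upd /fcons; case: unliftP => [k|] ->.
  by rewrite (inj_eq (@lift_inj _ ord0)).
by rewrite (negbTE (neq_lift _ _)).
Qed.
Lemma with_lift (T : Type) n (x : 'I_n.+1 -> T) i (y : T) :
  (fun j => upd x (lift ord0 i) y (lift ord0 j))
  = upd (fun j => x (lift ord0 j)) i y.
Proof. by apply/funext=> j; rewrite /upd (inj_eq (@lift_inj _ ord0)). Qed.

Lemma mlift_param (W' W : lmodType K) m
    (G : W' -> ('I_m -> U) -> ('I_m -> V) -> W) x :
  (forall us vs, linear (fun y => G y us vs)) -> linear (fun y => mlift (G y) x).
Proof.
elim: m G x => [|m IH] G x hG /=; first exact: hG.
by apply: tlift_param => u v; apply: IH => us vs; apply: hG.
Qed.

Lemma lin_mlift (W W' : lmodType K) (g : W -> W') m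
    (G : ('I_m -> U) -> ('I_m -> V) -> W) x :
  linear g -> g (mlift G x) = mlift (fun us vs => g (G us vs)) x.
Proof.
move=> lg; elim: m G x => [|m IH] G x //=.
by rewrite (lin_tlift _ _ lg); apply: eq_tlift => u v; rewrite IH.
Qed.

Lemma eq_mlift (W : lmodType K) m (G G' : ('I_m -> U) -> ('I_m -> V) -> W) x :
  (forall us vs, G us vs = G' us vs) -> mlift G x = mlift G' x.
Proof. by move=> h; congr (mlift _ x); apply/funext=> us; apply/funext=> vs. Qed.

Definition multilinear2 (W : lmodType K) m (G : ('I_m -> U) -> ('I_m -> V) -> W) :=
  (forall vs, multilinear (G^~ vs)) /\ (forall us, multilinear (G us)).

Section MliftS.
Variables (W : lmodType K) (m : nat).
Variable G : ('I_m.+1 -> U) -> ('I_m.+1 -> V) -> W.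
Hypothesis hG : multilinear2 G.

Lemma multilinear2_fcons u v :
  multilinear2 (fun us vs => G (fcons u us) (fcons v vs)).
Proof.
split=> [vs|us] b i a y z; rewrite -!fcons_withS; [exact: hG.1|exact: hG.2].
Qed.

Lemma mlift_bilin x :
  bilin (fun u v => mlift (fun us vs => G (fcons u us) (fcons v vs)) x).
Proof.
split=> [v|u]; apply: mlift_param => us vs a y z.
  by rewrite -(fcons_with0 0 (a *: y + z)) -(fcons_with0 0 y) -(fcons_with0 0 z); apply: hG.1.
by rewrite -(fcons_with0 0 (a *: y + z)) -(fcons_with0 0 y) -(fcons_with0 0 z); apply: hG.2.
Qed.
End MliftS.

Lemma mlift_pure (W : lmodType K) m (G : ('I_m -> U) -> ('I_m -> V) -> W) us vs :
  multilinear2 G -> mlift G (fun i => us i \ox vs i) = G us vs.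
Proof.
elim: m G us vs => [|m IH] G us vs hG /=.
  by congr G; apply/funext=> -[].
rewrite tlift_tpair; last exact: mlift_bilin.
by rewrite IH ?fcons_eta //; apply: multilinear2_fcons.
Qed.

Lemma mlift_multilinear (W : lmodType K) m (G : ('I_m -> U) -> ('I_m -> V) -> W) :
  multilinear2 G -> multilinear (mlift G).
Proof.
elim: m G => [|m IH] G hG x i; first by case: i.
case: (unliftP ord0 i) => [j|] ->.
  rewrite (_ : (fun y => _) = fun y =>
    tlift (fun u v => mlift (fun us vs => G (fcons u us) (fcons v vs))
      (upd (fun j => x (lift ord0 j)) j y)) (x ord0)); last first.
    by apply/funext=> y /=; rewrite with_lift /upd (negbTE (neq_lift _ _)).
  by apply: tlift_param => u v; apply: IH; apply: multilinear2_fcons.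
rewrite (_ : (fun y => _) = tlift (fun u v => mlift
    (fun us vs => G (fcons u us) (fcons v vs)) (fun j => x (lift ord0 j)))).
  by apply: tlift_linear; apply: mlift_bilin.
by apply/funext=> y /=; apply: eq_tlift => u v; congr mlift.
Qed.

Lemma mlift_id (W : lmodType K) m (g : ('I_m -> tensor U V) -> W) x :
  multilinear g -> mlift (fun us vs => g (fun i => us i \ox vs i)) x = g x.
Proof.
elim: m g x => [|m IH] g x hg /=; first by congr g; apply/funext=> -[].
transitivity (tlift (fun u v => g (fcons (u \ox v) (fun i => x (lift ord0 i)))) (x ord0)).
  apply: eq_tlift => u v.
  rewrite -(IH (fun xs => g (fcons (u \ox v) xs))); last first.
    by move=> b i a y z; rewrite -!fcons_withS; apply: hg.
  apply: eq_mlift => us vs; congr g; apply/funext=> i.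
  by rewrite /fcons; case: (unlift _ _).
have lg : linear (fun t => g (fcons t (fun i => x (lift ord0 i)))).
  by move=> a y z; rewrite -(fcons_with0 0 (a *: y + z)) -(fcons_with0 0 y) -(fcons_with0 0 z); apply: hg.
by rewrite -(lin_tlift (@tpair K U V) _ lg) -[tlift _ _]tensorE fcons_eta.
Qed.

Lemma multilinear_ext (W : lmodType K) m (g h : ('I_m -> tensor U V) -> W) :
  multilinear g -> multilinear h ->
  (forall us vs, g (fun i => us i \ox vs i) = h (fun i => us i \ox vs i)) ->
  g =1 h.
Proof.
by move=> hg hh e x; rewrite -(mlift_id x hg) -(mlift_id x hh); apply: eq_mlift.
Qed.
End Mlift.

Section TensorPower.
Variables (K : fieldType) (B : lmodType K).

(* The (n+1)-fold tensor power of B and its elementary tensors.               *)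
Fixpoint tpow (n : nat) : lmodType K :=
  if n is m.+1 then tensor B (tpow m) else B.

Fixpoint tpure n : ('I_n.+1 -> B) -> tpow n :=
  match n with
  | 0 => fun b => b ord0
  | m.+1 => fun b => b ord0 \ox tpure (fun i => b (lift ord0 i))
  end.

Fixpoint tpow_lift (W : nmodType) n : (('I_n.+1 -> B) -> W) -> tpow n -> W :=
  match n with
  | 0 => fun F x => F (fun=> x)
  | m.+1 => fun F => tlift (fun u => tpow_lift (fun us => F (fcons u us)))
  end.

Lemma tpow_lift_param (W W' : lmodType K) n (F : W' -> ('I_n.+1 -> B) -> W) t :
  (forall b, linear (F^~ b)) -> linear (fun y => tpow_lift (F y) t).
Proof.
elim: n F t => [|n IH] F t hF /=; first exact: hF.
by apply: tlift_param => u v; apply: IH => b; apply: hF.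
Qed.

Lemma fcons_multilinear (W : lmodType K) n (F : ('I_n.+1 -> B) -> W) u :
  multilinear F -> multilinear (fun us => F (fcons u us)).
Proof. by move=> hF b i a y z; rewrite -!fcons_withS; apply: hF. Qed.

Lemma fcons_linear (W : lmodType K) n (F : ('I_n.+1 -> B) -> W) us :
  multilinear F -> linear (fun u => F (fcons u us)).
Proof.
move=> hF a y z.
rewrite -(fcons_with0 0 (a *: y + z)) -(fcons_with0 0 y) -(fcons_with0 0 z).
exact: hF.
Qed.

Lemma tpow_liftP (W : lmodType K) n (F : ('I_n.+1 -> B) -> W) : multilinear F ->
  linear (tpow_lift F) /\ forall b, tpow_lift F (tpure b) = F b.
Proof.
elim: n F => [|n IH] F hF /=.
  split=> [|b]; last by congr F; apply/funext=> i; rewrite (ord1 i).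
  have e x : (fun=> x) = upd (fun=> 0 : B) (ord0 : 'I_1) x.
    by apply/funext=> i; rewrite /upd (ord1 i) eqxx.
  by move=> a x y; rewrite (e (a *: x + y)) (e x) (e y); apply: hF.
have hb : bilin (fun u => tpow_lift (fun us => F (fcons u us))).
  split=> [v|u]; first by apply: tpow_lift_param => b; apply: fcons_linear.
  exact: (IH _ (fcons_multilinear u hF)).1.
split=> [|b]; first exact: tlift_linear.
by rewrite tlift_tpair // (IH _ (fcons_multilinear _ hF)).2 fcons_eta.
Qed.

Lemma tpure_multilinear n : multilinear (@tpure n).
Proof.
elim: n => [|n IH] b i a x y /=; first by rewrite /upd (ord1 i) eqxx.
case: (unliftP ord0 i) => [j|] ->.
  by rewrite !with_lift IH (tpair_bilin _ _).2.
by rewrite /upd eqxx (tpair_bilin _ _).1.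
Qed.
End TensorPower.

HB.instance Definition _ (K : fieldType) (A : unitalAlgType K) :=
  Monoid.isLaw.Build A uone umul umulA umul1l umul1r.

(* (b_0, ..., b_(n+1)) |-> (b_0, ..., b_i b_(i+1), ..., b_(n+1)).             *)
Definition merge (K : fieldType) (B : unitalAlgType K) n (i : nat)
    (b : 'I_n.+2 -> B) : 'I_n.+1 -> B :=
  fun j => if (j < i)%N then b (widen_ord (leqnSn _) j)
           else if (j == i :> nat) then b (widen_ord (leqnSn _) j) ** b (lift ord0 j)
           else b (lift ord0 j).

(* (b_0, ..., b_n) |-> (g b_n, b_0, ..., b_(n-1)).                            *)
Definition rotate (B : Type) n (g : B -> B) (b : 'I_n.+1 -> B) : 'I_n.+1 -> B :=
  fun j => if j == ord0 then g (b ord_max) else b (ord_pred j).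

Section Cyclic.
Variables (K : fieldType) (H : unitalAlgType K) (hH : hopfAlgebra H).

Section Cochain.
Variables (B : unitalAlgType K) (act : moduleAlgebra hH B).

(* Linear functionals on H (x) B^(x)(n+1) are encoded as the multilinear      *)
(* functions in this space, see is_functionalP.                               *)
Definition cochain n := H -> ('I_n.+1 -> B) -> K^o.
HB.instance Definition _ n := GRing.Lmodule.on (cochain n).

Definition is_functional n (f : cochain n) :=
  (forall b, linear (f^~ b)) /\ (forall x, multilinear (f x)).

Lemma is_functionalP n (f : cochain n) :
  is_functional f <->
  exists F : tensor H (tpow B n) -> K^o,
    linear F /\ forall x b, f x b = F (x \ox tpure b).
Proof.
split=> [[f1 f2]|[F [lF e]]].
  have hb : bilin (fun x => tpow_lift (f x)).
    split=> [t|x]; first exact: tpow_lift_param.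
    exact: (tpow_liftP (f2 x)).1.
  exists (tlift (fun x => tpow_lift (f x))); split; first exact: tlift_linear.
  by move=> x b; rewrite tlift_tpair // (tpow_liftP (f2 x)).2.
split=> [b a x y|x b i a y z]; rewrite !e -lF; congr F.
  exact: (tpair_bilin _ _).1.
by rewrite tpure_multilinear; apply: (tpair_bilin _ _).2.
Qed.

Definition equivariant n (f : cochain n) := forall (x y : H) (b : 'I_n.+1 -> B),
  \sum_(w <- sweedler hH n.+2 x)
     f (antipodeV hH w`_0 ** y ** w`_1) (fun i => act (b i) w`_i.+2)
  = counit hH x * f y b.

Definition in_C n (f : cochain n) := is_functional f /\ equivariant f.

Definition cyc n (f : cochain n) : cochain n := fun x b =>
  \sum_(w <- sweedler hH 1 x) f w`_0 (rotate (act^~ w`_1) b).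

(* The coface d_i^(n+1), for 0 <= i <= n + 1.                                 *)
Definition dface n (i : nat) (f : cochain n) : cochain n.+1 :=
  if (i <= n)%N then fun x b => f x (merge i b)
  else cyc (fun x b => f x (merge 0 b)).

Definition hochb n (f : cochain n) : cochain n.+1 :=
  \sum_(i < n.+2) (-1) ^+ i *: dface i f.

Definition lam n (f : cochain n) : cochain n := (-1) ^+ n *: cyc f.

Definition in_Clam n (f : cochain n) := in_C f /\ lam f = f.

Definition cocycle n : {pred cochain n} :=
  fun f => `[< in_Clam f /\ hochb f = 0 >].

Definition coboundary n : {pred cochain n} :=
  match n with
  | 0 => fun f => `[< f = 0 >]
  | m.+1 => fun f => `[< exists2 g : cochain m, in_Clam g & f = hochb g >]
  end.

Lemma is_functional_closed n (a : K) (f g : cochain n) :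
  is_functional f -> is_functional g -> is_functional (a *: f + g).
Proof.
move=> [f1 f2] [g1 g2]; split=> [b c x y|x b i c y z].
  rewrite -[LHS]/(a * f (c *: x + y) b + g (c *: x + y) b).
  rewrite (f1 b) (g1 b) -[RHS]/(c * (a * f x b + g x b) + (a * f y b + g y b)).
  by rewrite /GRing.scale /= !mulrDr !mulrA [a * c]mulrC addrACA.
rewrite -[LHS]/(a * f x (upd b i (c *: y + z)) + g x (upd b i (c *: y + z))).
rewrite (f2 x b i) (g2 x b i).
rewrite -[RHS]/(c * (a * f x (upd b i y) + g x (upd b i y))
                + (a * f x (upd b i z) + g x (upd b i z))).
by rewrite /GRing.scale /= !mulrDr !mulrA [a * c]mulrC addrACA.
Qed.

Lemma equivariant_closed n (a : K) (f g : cochain n) :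
  equivariant f -> equivariant g -> equivariant (a *: f + g).
Proof.
move=> hf hg x y b.
rewrite -[RHS]/(counit hH x * (a * f y b + g y b)) mulrDr mulrCA -hf -hg.
by rewrite mulr_sumr -big_split.
Qed.

Lemma in_C_closed n (a : K) (f g : cochain n) :
  in_C f -> in_C g -> in_C (a *: f + g).
Proof.
move=> [f1 f2] [g1 g2]; split; first exact: is_functional_closed.
exact: equivariant_closed.
Qed.

Lemma in_C0 n : in_C (0 : cochain n).
Proof.
split; last by move=> x y b; rewrite mulr0 big1.
by split=> [b a x y|x b i a y z]; rewrite -[LHS]/(0 : K) -[RHS]/(a * 0 + 0 : K)
  mulr0 addr0.
Qed.

Lemma cyc_linear n : linear (@cyc n).
Proof.
move=> a f g; apply/funext=> x; apply/funext=> b.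
rewrite -[RHS]/(a * cyc f x b + cyc g x b).
by rewrite /cyc mulr_sumr -big_split.
Qed.

Lemma dface_linear n i : linear (@dface n i).
Proof.
move=> a f g; rewrite /dface; case: leqP => _ //.
by rewrite -cyc_linear.
Qed.

Lemma hochb_linear n : linear (@hochb n).
Proof.
apply: linear_bigsum => i a f g.
by rewrite dface_linear scalerDr !scalerA [_ * a]mulrC.
Qed.

Lemma lam_linear n : linear (@lam n).
Proof. by move=> a f g; rewrite /lam cyc_linear scalerDr !scalerA [_ * a]mulrC. Qed.

Lemma linear0' (V W : lmodType K) (f : V -> W) : linear f -> f 0 = 0.
Proof. by move=> lf; rewrite -[in LHS](scale0r 0) (lin_scale lf) scale0r. Qed.

Lemma in_Clam_closed n (a : K) (f g : cochain n) :
  in_Clam f -> in_Clam g -> in_Clam (a *: f + g).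
Proof.
move=> [f1 f2] [g1 g2]; split; first exact: in_C_closed.
by rewrite lam_linear f2 g2.
Qed.

Lemma in_Clam0 n : in_Clam (0 : cochain n).
Proof. by split; [exact: in_C0 | exact: linear0' (@lam_linear n)]. Qed.

Lemma cocycle_closed n : submod_closed (@cocycle n).
Proof.
split=> [|a f g /asboolP[f1 f2] /asboolP[g1 g2]]; apply/asboolP.
  by split; [exact: in_Clam0 | exact: linear0' (@hochb_linear n)].
by split; [exact: in_Clam_closed | rewrite hochb_linear f2 g2 scaler0 addr0].
Qed.
HB.instance Definition _ n :=
  GRing.isSubmodClosed.Build K (cochain n) (@cocycle n) (@cocycle_closed n).

Lemma coboundary_closed n : submod_closed (@coboundary n).
Proof.
case: n => [|n]; split.
- exact/asboolP.
- by move=> a f g /asboolP-> /asboolP->; apply/asboolP; rewrite scaler0 addr0.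
- apply/asboolP; exists 0; first exact: in_Clam0.
  by rewrite (linear0' (@hochb_linear n)).
- move=> a f g /asboolP[f' hf ->] /asboolP[g' hg ->]; apply/asboolP.
  by exists (a *: f' + g'); [exact: in_Clam_closed | rewrite hochb_linear].
Qed.
HB.instance Definition _ n :=
  GRing.isSubmodClosed.Build K (cochain n) (@coboundary n) (@coboundary_closed n).

(* The cohomology of (Ker(1 - lambda), b).                                    *)
Definition HC n := subquot (@cocycle n) (@coboundary n).
HB.instance Definition _ n := GRing.Lmodule.on (HC n).

End Cochain.

Section Morphism.
Variables (A B : unitalAlgType K).
Variables (aA : moduleAlgebra hH A) (aB : moduleAlgebra hH B).

Record cyclicMorphism (phi : forall n, cochain A n -> cochain B n) := {
  cyclic_linear : forall n, linear (@phi n);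
  cyclic_in_C : forall n (f : cochain A n), in_C aA f -> in_C aB (phi n f);
  cyclic_cyc : forall n (f : cochain A n), in_C aA f ->
    cyc aB (phi n f) = phi n (cyc aA f);
  cyclic_dface : forall n i (f : cochain A n), (i <= n.+1)%N -> in_C aA f ->
    dface aB i (phi n f) = phi n.+1 (dface aA i f)
}.

Variables (phi : forall n, cochain A n -> cochain B n) (hphi : cyclicMorphism phi).

Lemma cyclic_hochb n (f : cochain A n) : in_C aA f -> hochb aB (phi f) = phi (hochb aA f).
Proof.
move=> hf; rewrite (lin_sum (cyclic_linear hphi (n := n.+1))).
apply: eq_bigr=> i _; rewrite (cyclic_dface hphi) //; last exact: leq_ord.
by rewrite (lin_scale (cyclic_linear hphi (n := n.+1))).
Qed.

Lemma cyclic_in_Clam n (f : cochain A n) : in_Clam aA f -> in_Clam aB (phi f).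
Proof.
move=> [f1 f2]; split; first exact: (cyclic_in_C hphi).
rewrite /lam (cyclic_cyc hphi f1) -(lin_scale (cyclic_linear hphi (n := n))).
by congr phi.
Qed.

Lemma cyclic_cocycle n (f : cochain A n) : f \in @cocycle A aA n -> phi f \in @cocycle B aB n.
Proof.
move=> /asboolP[f1 f2]; apply/asboolP; split; first exact: cyclic_in_Clam.
rewrite (cyclic_hochb (proj1 f1)) f2; exact: linear0' (cyclic_linear hphi (n := n.+1)).
Qed.

Lemma cyclic_coboundary n (f : cochain A n) :
  f \in @coboundary A aA n -> phi f \in @coboundary B aB n.
Proof.
case: n f => [|n] f /asboolP.
  by move=> ->; apply/asboolP; apply: linear0' (cyclic_linear hphi (n := 0)).
move=> [g hg ->]; apply/asboolP; exists (phi g); first exact: cyclic_in_Clam.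
by rewrite (cyclic_hochb (proj1 hg)).
Qed.

Definition HCmap n : {linear HC aA n -> HC aB n} :=
  induced (cyclic_linear hphi (n := n)) (@cyclic_cocycle n) (@cyclic_coboundary n).

End Morphism.

Section PsiPhi.
Variable X : vectType K.
Local Notation E B := (tensor (endo X) B).

(* (Psi f)(x; (T_0 \ox b_0), ..., (T_n \ox b_n)) =                            *)
(*   f(x_(0); b_0, ..., b_n) Tr(pi(S^-1(x_(1))) T_0 ... T_n).                 *)
Definition Psi (pi : rightModule H X) (B : unitalAlgType K) n (f : cochain B n) :
    cochain (E B) n :=
  fun x t => \sum_(w <- sweedler hH 1 x)
    mlift (fun (T : 'I_n.+1 -> endo X) b =>
      f w`_0 b * trace (pi (antipodeV hH w`_1) ** \big[umul/uone]_(i < n.+1) T i)) t.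

Definition Phi (p : endo X) (B : unitalAlgType K) n (f : cochain (E B) n) :
    cochain B n :=
  fun x b => f x (fun i => p \ox b i).

Lemma trace_linear : linear (@trace K X).
Proof.
move=> a S T; rewrite /trace; set m := passmx.mxof _ _.
have -> : m (a *: S + T) = a *: m S + m T by apply: passmx.mxof_linear.
exact: linearP.
Qed.

Lemma trace_mulC (S T : endo X) : trace (S ** T) = trace (T ** S).
Proof.
by rewrite /trace !(passmx.mxof_comp _ _ (vbasisP _)) mxtrace_mulC.
Qed.

Section Slots.
Variable A : unitalAlgType K.

Lemma prod_multilinear n :
  multilinear (fun T : 'I_n -> A => \big[umul/uone]_(i < n) T i).
Proof.
have [ml mr] := @umul_bilin _ A.
elim: n => [|n IH] T i; first by case: i.
move=> a x y; rewrite !big_ord_recl; case: (unliftP ord0 i) => [j|] ->.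
  have h z k : upd T (lift ord0 j) z (lift ord0 k)
             = upd (fun k => T (lift ord0 k)) j z k.
    by rewrite /upd (inj_eq (@lift_inj _ ord0)).
  rewrite !(eq_bigr _ (fun k _ => h _ k)) IH /upd.
  by rewrite (negbTE (neq_lift _ _)) (mr _).
by rewrite /upd eqxx (ml _).
Qed.

Lemma prod_rotate n (T : 'I_n.+1 -> endo X) :
  trace (\big[umul/uone]_(i < n.+1) rotate id T i)
  = trace (\big[umul/uone]_(i < n.+1) T i).
Proof.
rewrite big_ord_recl big_ord_recr /= trace_mulC.
rewrite /rotate eqxx; congr (trace (_ ** _)); apply: eq_bigr=> i _.
congr T; apply: val_inj.
by rewrite /= add0n modnDr modn_small // ltnS ltnW.
Qed.

Lemma prod_merge n i (T : 'I_n.+2 -> A) : (i <= n)%N ->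
  \big[umul/uone]_(j < n.+1) merge i T j = \big[umul/uone]_(j < n.+2) T j.
Proof.
elim: i n T => [|i IH] n T hi.
  rewrite big_ord_recl [RHS]big_ord_recl big_ord_recl umulA.
  by congr (_ ** _); congr (_ ** _); congr T; apply: val_inj.
case: n T hi => // n T hi.
rewrite big_ord_recl [RHS]big_ord_recl; congr (_ ** _).
  by rewrite /merge; congr T; apply: val_inj.
rewrite -(IH n (fun k => T (lift ord0 k))) //; apply: eq_bigr=> j _.
rewrite /merge !lift0 ltnS eqSS.
have -> : widen_ord (leqnSn n.+2) (lift ord0 j) = lift ord0 (widen_ord (leqnSn n.+1) j).
  exact: val_inj.
by [].
Qed.

Lemma merge_upd n i (b : 'I_n.+2 -> A) k : (i <= n)%N ->
  exists k' (h : A -> A), linear h /\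
    forall x, merge i (upd b k x) = upd (merge i b) k' (h x).
Proof.
have [ml mr] := @umul_bilin _ A; move=> hi.
have wE (j : 'I_n.+1) (m : 'I_n.+2) :
  (widen_ord (leqnSn n.+1) j == m) = (j == m :> nat) by [].
have lE (j : 'I_n.+1) (m : 'I_n.+2) : (lift ord0 j == m) = (j.+1 == m :> nat) by [].
case: (ltngtP k i) => hk.
- have hk' : (k < n.+1)%N by lia.
  exists (Ordinal hk'), id; split=> // x; apply/funext=> j.
  rewrite /merge /upd !wE !lE -val_eqE /=.
  by case: (ltngtP j i) => hj; case: (ltngtP j k) => hjk; try lia; rewrite ?hjk //;
    case: eqP => //; lia.
- have hk' : (k.-1 < n.+1)%N by have := ltn_ord k; lia.
  case: (eqVneq (k : nat) i.+1) => hki.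
    have hi' : (i < n.+1)%N by [].
    exists (Ordinal hi'), (fun x => b (widen_ord (leqnSn _) (Ordinal hi')) ** x).
    split=> [|x]; first exact: mr.
    apply/funext=> j; rewrite /merge /upd !wE !lE -val_eqE /= hki /=.
    case: (ltngtP j i) => hj.
    + by case: eqP => //; lia.
    + by case: eqP => //; lia.
    + case: eqP => [|_]; first lia.
      rewrite hj eqxx; congr (b _ ** _); exact: val_inj.
  exists (Ordinal hk'), id; split=> // x; apply/funext=> j.
  rewrite /merge /upd !wE !lE -val_eqE /=.
  by case: (ltngtP j i) => hj; repeat case: eqP => //; lia.
- have hi' : (i < n.+1)%N by [].
  exists (Ordinal hi'), (fun x => x ** b (lift ord0 (Ordinal hi'))).
  split=> [|x]; first exact: ml.
  apply/funext=> j; rewrite /merge /upd !wE !lE -val_eqE /= hk.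
  case: (ltngtP j i) => hj //.
  + by case: eqP => //; lia.
  + by case: eqP => [|_]; [lia | congr (_ ** b _); apply: val_inj; rewrite /= hj].
Qed.

Lemma rotate_upd n (g : A -> A) (b : 'I_n.+1 -> A) k : linear g ->
  exists k' (h : A -> A), linear h /\
    forall x, rotate g (upd b k x) = upd (rotate g b) k' (h x).
Proof.
move=> lg; have pE (j : 'I_n.+1) : j != ord0 -> ord_pred j = j.-1 :> nat.
  move=> hj; have {}hj : (0 < j)%N by rewrite lt0n.
  rewrite /=; have -> : (j + n.+1).-1 = (j.-1 + n.+1)%N by lia.
  by rewrite modnDr modn_small //; have := ltn_ord j; lia.
case: (eqVneq k ord_max) => [->|hk].
  exists ord0, g; split=> // x; apply/funext=> j; rewrite /rotate /upd eqxx.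
  case: (eqVneq j ord0) => // hj; case: eqP => // /(congr1 val) /=.
  have := pE j hj; have := ltn_ord j; have : (0 < j)%N by rewrite lt0n.
  by move=> /= *; lia.
have hk' : (k.+1 < n.+1)%N.
  by have := ltn_ord k; move: hk; rewrite -val_eqE /=; lia.
exists (Ordinal hk'), id; split=> // x; apply/funext=> j; rewrite /rotate /upd.
rewrite [ord_max == k]eq_sym (negbTE hk).
case: (eqVneq j ord0) => [->|hj] //.
have e := pE j hj; rewrite -!val_eqE; move: e; rewrite /= => ->.
have : (0 < j)%N by rewrite lt0n.
by move=> ?; do 2 case: eqP => //; lia.
Qed.

Lemma map_upd (V : lmodType K) n (g : 'I_n -> A -> V) (b : 'I_n -> A) k x :
  (fun i => g i (upd b k x i)) = upd (fun i => g i (b i)) k (g k x).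
Proof. by apply/funext=> i; rewrite /upd; case: eqP => [->|]. Qed.

End Slots.

Lemma merge_functional (A : unitalAlgType K) n i (f : cochain A n) : (i <= n)%N ->
  is_functional f -> is_functional (fun x b => f x (merge i b) : K^o).
Proof.
move=> hi [f1 f2]; split=> [b|x b k]; first exact: f1.
have [k' [h [lh e]]] := merge_upd b k hi.
by move=> a y z; rewrite !e lh; apply: f2.
Qed.

Lemma rotate_functional (A : unitalAlgType K) (aA : moduleAlgebra hH A) n
  (f : cochain A n) : is_functional f -> is_functional (cyc aA f).
Proof.
move=> [f1 f2]; split=> [b|x b k].
  have -> : (cyc aA f)^~ b =
     tlift (fun u v => f u (rotate (aA^~ v) b)) \o comul hH.
    apply/funext=> x; rewrite /cyc.
    exact: (sum_sweedler1 (W := K^o) hH x (fun u v => f u (rotate (aA^~ v) b))).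
  move=> a x y; rewrite /= linearP; apply: tlift_linear; split=> [v|u].
    exact: f1.
  have e v : rotate (aA^~ v) b = upd (rotate id b) ord0 (aA (b ord_max) v).
    by apply/funext=> j; rewrite /rotate /upd; case: eqP.
  by move=> c v v'; rewrite !e (act_linr aA); apply: f2.
apply: linear_bigsum=> w.
have [k' [h [lh e]]] := rotate_upd b k (act_linl aA w`_1).
by move=> a y z; rewrite !e lh; apply: f2.
Qed.

Section PsiTriv.
Variables (B : unitalAlgType K) (act : moduleAlgebra hH B).
Local Notation eact := (endT_trivial X act).
Local Notation Psi0 := (@Psi (trivModule hH X) B _).

Let PsiG n (f : cochain B n) x := fun (T : 'I_n.+1 -> endo X) b =>
  f x b * trace (\big[umul/uone]_(i < n.+1) T i) : K^o.

Let PsiG_multilinear n (f : cochain B n) x :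
  is_functional f -> multilinear2 (PsiG f x).
Proof.
move=> [f1 f2]; split=> [b|T] c i a y z; rewrite /PsiG.
  have /= -> := prod_multilinear c i a y z.
  by rewrite trace_linear mulrDr -[a *: _]/(a * _ : K) mulrCA.
by have /= -> := f2 x c i a y z; rewrite mulrDl -[(a *: _ : K^o)]/(a * _ : K) -mulrA.
Qed.

Lemma Psi_trivE n (f : cochain B n) x t : is_functional f ->
  Psi0 f x t = mlift (PsiG f x) t.
Proof.
move=> [f1 f2]; rewrite /Psi.
have lg : linear (fun y => mlift (PsiG f y) t).
  apply: mlift_param => us vs a y z.
  by have /= e := f1 vs a y z; rewrite /PsiG e mulrDl -[(a *: _ : K^o)]/(a * _ : K) -mulrA.
rewrite -(lin_counitr hH x lg) -sum_sweedler1; apply: eq_bigr=> w _.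
have ls : linear (fun y : K^o => counit hH w`_1 *: y).
  by move=> a y z; rewrite scalerDr !scalerA [_ * a]mulrC.
rewrite (lin_mlift _ _ ls); apply: eq_mlift=> us vs /=.
rewrite counit_antipodeV (lin_scale ((@umul_bilin _ _).1 _)) umul1l.
by rewrite (lin_scale trace_linear) /PsiG /GRing.scale /= mulrCA.
Qed.

Lemma Psi_pure n (f : cochain B n) x T b : is_functional f ->
  Psi0 f x (fun i => T i \ox b i) =
  f x b * trace (\big[umul/uone]_(i < n.+1) T i).
Proof. by move=> hf; rewrite Psi_trivE // mlift_pure //; apply: PsiG_multilinear. Qed.

Lemma Psi_linear n : linear (@Psi (trivModule hH X) B n).
Proof.
move=> a f g; apply/funext=> x; apply/funext=> t; rewrite /Psi.
rewrite -[RHS]/(a * _ + _ : K) mulr_sumr -big_split; apply: eq_bigr=> w _ /=.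
pose G (h : cochain B n) := fun (T : 'I_n.+1 -> endo X) b =>
  h w`_0 b * trace (trivModule hH X (antipodeV hH w`_1) **
     \big[umul/uone]_(i < n.+1) T i) : K^o.
have lG : linear (fun h => mlift (G h) t).
  apply: mlift_param => us vs c h h'.
  by rewrite /G -[(c *: h + h') _ _]/(c * h w`_0 vs + h' w`_0 vs) mulrDl -mulrA.
exact: lG.
Qed.

Lemma Psi_functional n (f : cochain B n) :
  is_functional f -> is_functional (Psi0 f).
Proof.
move=> hf; have [f1 f2] := hf; split=> [t a x y|x].
  rewrite !Psi_trivE //.
  have lg : linear (fun y => mlift (PsiG f y) t); last exact: lg.
  apply: mlift_param => us vs c u v.
  by have /= e := f1 vs c u v; rewrite /PsiG e mulrDl -[(c *: _ : K^o)]/(c * _ : K) -mulrA.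
have -> : Psi0 f x = mlift (PsiG f x) by apply/funext=> t; rewrite Psi_trivE.
by apply: mlift_multilinear; apply: PsiG_multilinear.
Qed.

Lemma endT_map_pair n (T : 'I_n -> endo X) b (v : 'I_n -> H) :
  (fun i => eact (T i \ox b i) (v i)) = (fun i => T i \ox act (b i) (v i)).
Proof. by apply/funext=> i; apply: endT_pair. Qed.

Lemma Psi_in_C n (f : cochain B n) : in_C act f -> in_C eact (Psi0 f).
Proof.
move=> [ff fe]; split; first exact: Psi_functional.
have [_ P2] := Psi_functional ff; move=> x y t; move: t.
apply: multilinear_ext.
- move=> t k; apply: linear_bigsum=> w a u v.
  rewrite !(map_upd (fun i z => eact z w`_i.+2)) (act_linl eact); exact: P2.
- by move=> t k a u v; have /= -> := P2 y t k a u v;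
    rewrite mulrDr /GRing.scale /= mulrCA.
move=> T b; rewrite Psi_pure // mulrA -fe mulr_suml; apply: eq_bigr=> w _.
by rewrite (endT_map_pair _ _ (fun i => w`_i.+2)) Psi_pure.
Qed.

Lemma rotate_pair n (T : 'I_n.+1 -> endo X) b h :
  rotate (eact^~ h) (fun i => T i \ox b i)
  = (fun i => rotate id T i \ox rotate (act^~ h) b i).
Proof.
by apply/funext=> i; rewrite /rotate; case: eqP => // _; apply: endT_pair.
Qed.

Lemma merge_pair n k (T : 'I_n.+2 -> endo X) (b : 'I_n.+2 -> B) :
  merge k (fun i => T i \ox b i) = (fun i => merge k T i \ox merge k b i).
Proof.
apply/funext=> i; rewrite /merge; case: ltnP => // _; case: eqP => // _.
exact: tmul_pair.
Qed.

Lemma Psi_cyc n (f : cochain B n) : is_functional f ->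
  cyc eact (Psi0 f) = Psi0 (cyc act f).
Proof.
move=> ff; have cf := rotate_functional act ff.
apply/funext=> x; apply/funext; apply: multilinear_ext.
- exact: (rotate_functional eact (Psi_functional ff)).2.
- exact: (Psi_functional cf).2.
move=> T b; rewrite Psi_pure // mulr_suml; apply: eq_bigr=> w _.
by rewrite rotate_pair Psi_pure // prod_rotate.
Qed.

Lemma Psi_merge n k (f : cochain B n) : (k <= n)%N -> is_functional f ->
  (fun x t => Psi0 f x (merge k t)) = Psi0 (fun x b => f x (merge k b)).
Proof.
move=> hk ff; have mf := merge_functional hk ff.
apply/funext=> x; apply/funext; apply: multilinear_ext.
- exact: (merge_functional hk (Psi_functional ff)).2.
- exact: (Psi_functional mf).2.
by move=> T b; rewrite merge_pair !Psi_pure // prod_merge.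
Qed.

Lemma Psi_cyclic : cyclicMorphism act eact (@Psi (trivModule hH X) B).
Proof.
split=> [n|n f|n f [ff _]|n i f hi [ff _]].
- exact: Psi_linear.
- exact: Psi_in_C.
- exact: Psi_cyc.
rewrite /dface; case: leqP => h; first exact: Psi_merge.
by rewrite Psi_merge // Psi_cyc //; apply: merge_functional.
Qed.

Section PhiP.
Variable p : endo X.
Hypothesis p_idem : p ** p = p.

Lemma Phi_cyclic : cyclicMorphism eact act (@Phi p B).
Proof.
have rot n h (b : 'I_n.+1 -> B) : rotate (eact^~ h) (fun i => p \ox b i)
    = (fun i => p \ox rotate (act^~ h) b i).
  by apply/funext=> i; rewrite /rotate; case: eqP => // _; apply: endT_pair.
have mrg n k (b : 'I_n.+2 -> B) : merge k (fun i => p \ox b i)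
    = (fun i => p \ox merge k b i).
  apply/funext=> i; rewrite /merge; case: ltnP => // _; case: eqP => // _.
  by rewrite -[in RHS]p_idem; apply: tmul_pair.
have cycE n (f : cochain (E B) n) : cyc act (Phi p f) = Phi p (cyc eact f).
  apply/funext=> x; apply/funext=> b; apply: eq_bigr=> w _.
  by rewrite /Phi -rot.
have mE n k (f : cochain (E B) n) :
    (fun x b => Phi p f x (merge k b)) = Phi p (fun x b => f x (merge k b)).
  by apply/funext=> x; apply/funext=> b; rewrite /Phi mrg.
split=> [n|n f [[f1 f2] fe]|n f _|n i f hi _] //.
- split; first split=> [b|x b k a u v]; first exact: f1.
    rewrite /Phi !(map_upd (fun=> tpair p)) (tpair_bilin _ _).2; exact: f2.
  move=> x y b; rewrite -fe; apply: eq_bigr=> w _; congr (f _ _).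
  by apply/funext=> i; symmetry; apply: endT_pair.
- by rewrite /dface mE; case: leqP => h //; rewrite -cycE -mE.
Qed.

End PhiP.
End PsiTriv.

(* [Psi^n] for the trivial right module structure on X.                       *)
Definition HC_Psi (B : unitalAlgType K) (act : moduleAlgebra hH B) n :
    {linear HC act n -> HC (endT_trivial X act) n} :=
  HCmap (Psi_cyclic act) n.

Definition HC_Phi (B : unitalAlgType K) (act : moduleAlgebra hH B) (p : endo X)
    (p_idem : p ** p = p) n : {linear HC (endT_trivial X act) n -> HC act n} :=
  HCmap (Phi_cyclic act p_idem) n.

End PsiPhi.
End Cyclic.

(* Main.v *)
(**
Write A = End(X) (x) (End(X) (x) B), and let sigma be the flip of the two copies
of End(X).  For a cocycle f on End(X) (x) B put g = Psi f on A.  Pulling g back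
along T (x) b |-> p (x) (T (x) b) gives f, because Tr p = 1; pulling back the
conjugate of g by sigma gives Psi (Phi_p f).  So it is enough that conjugation
by sigma = 1 - 2e, with e an invariant idempotent, does not change the class of
a cyclic cocycle.

Inserting e with alternating signs after each argument defines an operator
[htpy] on cochains which preserves the cyclic ones and satisfies
h b + b h = (the infinitesimal action of e, up to sign).  The conjugates of f by
1 + (z - 1) e, for z <> 0, are cocycles; on tensors homogeneous for the grading
by e they are z^k f where the infinitesimal action is multiplication by -k.  As
only finitely many weights k occur, a Vandermonde argument produces a
combination of these conjugates which the infinitesimal action sends to
f o Ad(sigma) - f, and the latter is then a coboundary by the homotopy formula.
*)
Require Import Defs.
From HB Require Import structures.
From mathcomp Require Import all_boot all_order all_algebra.
From mathcomp Require Import boolp functions reals complex.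
From mathcomp Require Import zify ring.
Import GRing.Theory Num.Theory.
Local Open Scope ring_scope.

Set Implicit Arguments.
Unset Strict Implicit.
Unset Printing Implicit Defensive.

Local Notation merge := Defs.merge.

Lemma val_inord n m : (inord m : 'I_n.+1) = (if (m <= n)%N then m else 0%N) :> nat.
Proof. by rewrite /inord val_insubd ltnS. Qed.

(* Families are read at natural number positions, as x (inord j), so that every
   identity between reindexed families is a case analysis closed by lia. *)
Ltac ordcase :=
  rewrite ?val_inord /=;
  repeat match goal with
  | |- context [if ?b then _ else _] =>
      lazymatch b with context [if _ then _ else _] => fail | _ => idtac end;
      first [ have -> : b = true by lia | have -> : b = false by lia
            | let h := fresh "h" in case h : b ]
  end;
  try done; try (exfalso; lia);
  repeat match goal with
  | |- context [?f (inord ?a)] => match goal with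
     | |- context [f (inord ?b)] =>
       tryif constr_eq a b then fail else have -> : a = b by lia end
  end;
  try done.

(** * Inserting an element into a family, against merging and rotation *)

Section Insertion.
Variables (K : fieldType) (A : unitalAlgType K).

Definition insert n (k : nat) (a : A) (x : 'I_n.+1 -> A) : 'I_n.+2 -> A :=
  fun j => if (j < k)%N then x (inord j)
           else if (j == k :> nat) then a else x (inord j.-1).

Lemma inordE (T : Type) n (x : 'I_n.+1 -> T) (i : 'I_n.+1) : x i = x (inord i).
Proof. by rewrite inord_val. Qed.

Lemma mergeE n i (x : 'I_n.+2 -> A) (j : 'I_n.+1) :
  merge i x j = if (j < i)%N then x (inord j)
                else if j == i :> nat then x (inord j) ** x (inord j.+1)
                else x (inord j.+1).
Proof.
rewrite /merge (inordE x (widen_ord _ _)) (inordE x (lift _ _)).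
by rewrite lift0.
Qed.

Lemma ord_predE n (j : 'I_n.+1) : j != ord0 -> ord_pred j = j.-1 :> nat.
Proof.
move=> hj; have {}hj : (0 < j)%N by rewrite lt0n.
rewrite /=; have -> : (j + n.+1).-1 = (j.-1 + n.+1)%N by lia.
by rewrite modnDr modn_small //; have := ltn_ord j; lia.
Qed.

Lemma rotateE n g (x : 'I_n.+1 -> A) (j : 'I_n.+1) :
  rotate g x j = if j == 0 :> nat then g (x (inord n)) else x (inord j.-1).
Proof.
rewrite /rotate -val_eqE /=; case: eqP => [_|/eqP hj].
  by rewrite (inordE x ord_max).
by rewrite (inordE x) ord_predE.
Qed.

Lemma updE n (x : 'I_n.+1 -> A) (k : 'I_n.+1) y j :
  upd x k y j = if j == k :> nat then y else x (inord j).
Proof. by rewrite /upd -val_eqE /= -inordE. Qed.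

Lemma insert_upd n k a (x : 'I_n.+1 -> A) (i : 'I_n.+1) : (k <= n.+1)%N ->
  exists i' : 'I_n.+2, forall y, insert k a (upd x i y) = upd (insert k a x) i' y.
Proof.
move=> hk; have hi := ltn_ord i.
exists (inord (if (i < k)%N then nat_of_ord i else i.+1)) => y; apply/funext => j.
have hj := ltn_ord j; rewrite !updE /insert !updE.
ordcase.
Qed.

Lemma insert_rotate n k g a (x : 'I_n.+1 -> A) : (k <= n)%N ->
  insert k.+1 a (rotate g x) = rotate g (insert k a x).
Proof.
move=> hk; apply/funext => j; have hj := ltn_ord j.
rewrite rotateE /insert !rotateE.
ordcase.
Qed.

Lemma rotate_insert_last n g a (x : 'I_n.+1 -> A) :
  rotate g (insert n.+1 a x) = insert 0 (g a) x.
Proof.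
apply/funext => j; have hj := ltn_ord j.
rewrite rotateE /insert. ordcase.
Qed.

(** With [a] at position [i.+1], the merging faces fall into four ranges: those strictly to the left
    of [a], the two that absorb [a] into a neighbour, and those strictly to the right. The rotated
    last face comes after them. *)
Lemma merge_insert_lt n i j a (x : 'I_n.+2 -> A) : (j < i <= n.+1)%N ->
  merge j (insert i.+1 a x) = insert i a (merge j x).
Proof.
move=> hk; apply/funext => k; have hj := ltn_ord k.
rewrite mergeE /insert !mergeE. ordcase.
Qed.

Lemma merge_insert_eq n (i : 'I_n.+2) a (x : 'I_n.+2 -> A) :
  merge i (insert i.+1 a x) = upd x i (x i ** a).
Proof.
apply/funext => k; have hj := ltn_ord k. have := ltn_ord i => hi.
rewrite mergeE /insert updE (inordE x i). ordcase.
Qed.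

Lemma merge_insert_eqS n (i : nat) a (x : 'I_n.+2 -> A) :  (i <= n)%N ->
  merge i.+1 (insert i.+1 a x) = upd x (inord i.+1) (a ** x (inord i.+1)).
Proof.
move=> hi; apply/funext => k; have hj := ltn_ord k.
rewrite mergeE /insert updE. ordcase.
Qed.

Lemma merge_insert_gt n i j a (x : 'I_n.+2 -> A) : (i < j <= n)%N ->
  merge j.+1 (insert i.+1 a x) = insert i.+1 a (merge j x).
Proof.
move=> hk; apply/funext => k; have hj := ltn_ord k.
rewrite mergeE /insert !mergeE. ordcase.
Qed.

Lemma merge0_rotate_insert n i g a (x : 'I_n.+2 -> A) : (i <= n)%N ->
  merge 0 (rotate g (insert i.+1 a x)) = insert i.+1 a (merge 0 (rotate g x)).
Proof.
move=> hk; apply/funext => k; have hj := ltn_ord k.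
rewrite mergeE /insert !mergeE !rotateE. ordcase.
Qed.

Lemma merge0_rotate_insert_last n g a (x : 'I_n.+2 -> A) :
  merge 0 (rotate g (insert n.+2 a x)) = upd x ord0 (g a ** x ord0).
Proof.
apply/funext => k; have hj := ltn_ord k.
rewrite mergeE !rotateE /insert updE (inordE x ord0). ordcase.
Qed.
End Insertion.

(** The indices $j<i$ yield the entries $Q_{j'i'}$ with $j'\le i'$, the indices $j>i+1$ those with
    $j'>i'$, so each entry of the smaller square occurs once; lowering one index flips its sign.
    Only the two diagonals [r] and [s] are left. *)
Lemma alternating_telescope (V : comNzRingType) (Q : nat -> nat -> V) (r s : nat -> V) N :
  \sum_(0 <= i < N.+1) \sum_(0 <= j < N.+1) (-1) ^+ (i + j) *
     (if (j < i)%N then Q j i.-1 else if j == i then r i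
      else if j == i.+1 then s j else Q j.-1 i)
  = \sum_(0 <= i < N.+1) r i - \sum_(0 <= i < N) s i.+1
    - \sum_(0 <= i < N) \sum_(0 <= j < N) (-1) ^+ (i + j) * Q j i.
Proof.
pose F i j := if (j < i)%N then Q j i.-1 else if j == i then r i
  else if j == i.+1 then s j else Q j.-1 i.
under eq_bigr do under eq_bigr do rewrite -/(F _ _).
elim: N => [|N IH].
  by rewrite !big_nat1 !big_geq //= !subr0 expr0 mul1r.
have cut (G : nat -> nat -> V) M :
    \sum_(0 <= i < M.+1) \sum_(0 <= j < M.+1) G i j =
    \sum_(0 <= i < M) \sum_(0 <= j < M) G i j
    + (\sum_(0 <= i < M) G i M + \sum_(0 <= j < M) G M j + G M M).
  rewrite big_nat_recr //= (big_nat_recr _ _ _ (leq0n M)) /=.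
  under eq_bigr do rewrite big_nat_recr //=.
  by rewrite big_split /= -!addrA.
rewrite cut [\sum_(0 <= i < N.+1) (_ * _)]big_nat_recr //=.
have sgn i j : (-1) ^+ (i + j.+1) = - (-1) ^+ (i + j) :> V.
  by rewrite addnS exprS mulN1r.
have sgn2 i : (-1) ^+ (i + i) = 1 :> V by rewrite addnn -mul2n exprM sqrrN !expr1n.
have -> : \sum_(0 <= i < N) (-1) ^+ (i + N.+1) * F i N.+1
   = - \sum_(0 <= i < N) (-1) ^+ (i + N) * Q N i.
  rewrite -sumrN; apply: eq_big_nat => i hi; rewrite sgn mulNr /F.
  have -> : (N.+1 < i)%N = false by lia.
  have -> : (N.+1 == i) = false by lia.
  by have -> : (N.+1 == i.+1) = false by lia.
have -> : \sum_(0 <= j < N.+1) (-1) ^+ (N.+1 + j) * F N.+1 j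
   = - \sum_(0 <= j < N.+1) (-1) ^+ (N + j) * Q j N.
  rewrite -sumrN; apply: eq_big_nat => i hi.
  by rewrite addnC sgn addnC mulNr /F (_ : (i < N.+1)%N).
have -> : F N N.+1 = s N.+1 by rewrite /F ltnNge leqnSn /= eqn_leq ltnn /= eqxx.
have -> : F N.+1 N.+1 = r N.+1 by rewrite /F ltnn eqxx.
rewrite IH sgn !sgn2 mul1r mulN1r cut sgn2 mul1r.
rewrite (big_nat_recr N.+1) //= (big_nat_recr N _ (fun i => s i.+1)) //=.
rewrite (big_nat_recr N _ (fun j => _ * Q j N)) //= sgn2 mul1r.
ring.
Qed.

(** * Iterated comultiplication and the counit *)

Section Sweedler.
Variables (K : fieldType) (H : unitalAlgType K) (hH : hopfAlgebra H).
Variable W : lmodType K.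

Lemma antipodeV_linear : linear (antipodeV hH).
Proof.
move=> a x y; apply: (can_inj (antipodeK hH)).
by rewrite linearP /= !antipodeVK.
Qed.

(** Lists of legs stand for elementary tensors, so multilinearity on $\mathcal H^{\otimes(n+1)}$ is
    expressed by replacing one entry of a list. *)
Definition entrywise_linear n (F : seq H -> W) :=
  forall w i, (i <= n)%N -> linear (fun y => F (set_nth 0 w i y)).

Lemma entrywise_linear_cons n (F : seq H -> W) x :
  entrywise_linear n.+1 F -> entrywise_linear n (fun w => F (x :: w)).
Proof. by move=> hF w i hi; apply: (hF (x :: w) i.+1). Qed.

Lemma sum_sweedler_linear n (F : seq H -> W) : entrywise_linear n F ->
  linear (fun x => \sum_(w <- sweedler hH n x) F w).
Proof.
elim: n F => [|n IH] F hF a x y.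
  by rewrite !big_seq1; apply: (hF [::] 0%N).
rewrite !sum_sweedlerS linearP; apply: tlift_linear; split=> [v|u].
  by apply: linear_bigsum => w; apply: (hF (0 :: w) 0%N).
exact: (IH (fun w => F (u :: w)) (entrywise_linear_cons u hF)).
Qed.

Fixpoint del (T : Type) (k : nat) (s : seq T) : seq T :=
  match k, s with
  | _, [::] => [::]
  | 0, _ :: s' => s'
  | k'.+1, x :: s' => x :: del k' s'
  end.

Lemma nth_del (T : Type) (x0 : T) k s i : nth x0 (del k s) i = nth x0 s (bump k i).
Proof.
elim: s k i => [|x s IH] [|k] [|i] //=; rewrite ?nth_nil // ?IH //.
by rewrite bumpS.
Qed.

(** The recursion descends to the level at which leg [k] splits off. There the left counit law
    erases it, or the right one if it is the last leg. *)
Lemma sum_sweedler_counit n k x (F : seq H -> W) :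
  (k <= n.+1)%N -> entrywise_linear n F ->
  \sum_(w <- sweedler hH n.+1 x) counit hH w`_k *: F (del k w)
  = \sum_(w <- sweedler hH n x) F w.
Proof.
elim: k n x F => [|k IH] n x F hk hF; rewrite sum_sweedlerS.
  rewrite -[RHS](lin_counitl hH x (sum_sweedler_linear hF)).
  by apply: eq_tlift => a b; rewrite /= scaler_sumr.
case: n hk hF => [|n] hk hF.
  have -> : k = 0%N by lia.
  rewrite sum_sweedler0 -(lin_counitr hH x (hF [::] 0%N _)) //.
  by apply: eq_tlift => a b; rewrite sum_sweedler0.
rewrite sum_sweedlerS; apply: eq_tlift => a b.
exact: (IH n b (fun w => F (a :: w)) hk (entrywise_linear_cons a hF)).
Qed.
End Sweedler.

Lemma linear_scaled (K : fieldType) (V W : lmodType K) c (f : V -> W) :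
  linear f -> linear (fun x => c *: f x).
Proof. by move=> lf a x y; rewrite lf scalerDr !scalerA mulrC. Qed.

(** * The homotopy attached to an invariant element *)

Section Homotopy.
Variables (K : fieldType) (H : unitalAlgType K) (hH : hopfAlgebra H).
Variables (A : unitalAlgType K) (aA : moduleAlgebra hH A) (a : A).
Local Notation cochain := (@Defs.cochain K H).
Hypothesis a_inv : forall h, aA a h = counit hH h *: a.

Lemma hochbE n (f : cochain A n) x b :
  hochb aA f x b = \sum_(0 <= j < n.+2) (-1) ^+ j * dface aA j f x b.
Proof.
rewrite big_mkord; have lev : linear (fun f : cochain A n.+1 => f x b : K^o) by [].
exact: lin_sum lev _ _ _.
Qed.

(** The insertion positions are $1,\dots,n+1$. Position $0$ is left out, since on cyclic cochains it
    agrees with position $n+1$ up to sign. *)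
Definition htpy n (g : cochain A n.+1) : cochain A n := fun x b =>
  \sum_(0 <= i < n.+1) (-1) ^+ i *: (g x (insert i.+1 a b) : K^o).

Lemma htpy0 n : htpy (0 : cochain A n.+1) = 0.
Proof.
by apply/funext => x; apply/funext => b; rewrite /htpy big1 // => i _; apply: scaler0.
Qed.

(** For multilinear [f], this is the Lie derivative along the inner derivation $x\mapsto xa-ax$. *)
Definition inner n (f : cochain A n) : cochain A n := fun x b =>
  \sum_(i < n.+1) (f x (upd b i (b i ** a)) - f x (upd b i (a ** b i))).

Lemma insert_functional n k (g : cochain A n.+1) : (k <= n.+1)%N ->
  is_functional g -> is_functional (fun x b => g x (insert k a b) : K^o).
Proof.
move=> hk [g1 g2]; split=> [b|x b i c y z]; first exact: g1.
by have [i' e] := insert_upd a b i hk; rewrite !e; apply: g2.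
Qed.

Lemma htpy_functional n (g : cochain A n.+1) :
  is_functional g -> is_functional (htpy g).
Proof.
move=> hg; split=> [b c y z|x b i c y z]; rewrite /htpy !big_mkord.
  rewrite scaler_sumr -big_split; apply: eq_bigr => i _ /=.
  have [g1 _] := insert_functional (ltn_ord i) hg.
  exact: (linear_scaled _ (g1 b)).
rewrite scaler_sumr -big_split; apply: eq_bigr => j _ /=.
have [_ g2] := insert_functional (ltn_ord j) hg.
exact: (linear_scaled _ (g2 x b i)).
Qed.

Lemma insert_upd_self n k (b : 'I_n.+1 -> A) v : (k <= n.+1)%N ->
  insert k v b = upd (insert k a b) (inord k) v.
Proof.
move=> hk; apply/funext => j; have hj := ltn_ord j.
by rewrite updE /insert; ordcase.
Qed.

Lemma insert_slot_linear n k (g : cochain A n.+1) y b : (k <= n.+1)%N ->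
  is_functional g -> linear (fun v => g y (insert k v b) : K^o).
Proof.
move=> hk [_ g2] c u v.
rewrite (insert_upd_self b (c *: u + v) hk).
by rewrite (insert_upd_self b u hk) (insert_upd_self b v hk); apply: g2.
Qed.

Let G n (g : cochain A n.+1) y (b : 'I_n.+1 -> A) k (w : seq H) : K^o :=
  g (antipodeV hH w`_0 ** y ** w`_1) (insert k a (fun i => aA (b i) w`_i.+2)).

Let G_linear n (g : cochain A n.+1) y b k : (k <= n.+1)%N ->
  is_functional g -> entrywise_linear n.+2 (G g y b k).
Proof.
have [ml mr] := @umul_bilin _ H.
move=> hk hg w [|[|i]] hi; have [g1 g2] := insert_functional hk hg.
- have -> : (fun z => G g y b k (set_nth 0 w 0 z)) =
    (fun z => g (antipodeV hH z ** y ** w`_1)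
    (insert k a (fun i => aA (b i) w`_i.+2))).
    apply/funext => z; rewrite /G !nth_set_nth /=; congr (g _ (insert _ _ _)).
    by apply/funext => i; rewrite nth_set_nth.
  apply: (lin_comp (g1 _)); apply: (lin_comp (ml _)); apply: (lin_comp (ml _)).
  exact: antipodeV_linear.
- have -> : (fun z => G g y b k (set_nth 0 w 1 z)) =
    (fun z => g (antipodeV hH w`_0 ** y ** z)
    (insert k a (fun i => aA (b i) w`_i.+2))).
    apply/funext => z; rewrite /G !nth_set_nth /=; congr (g _ (insert _ _ _)).
    by apply/funext => i; rewrite nth_set_nth.
  by apply: (lin_comp (g1 _)); apply: mr.
- have -> : (fun z => G g y b k (set_nth 0 w i.+2 z)) =
    (fun z => g (antipodeV hH w`_0 ** y ** w`_1)
    (insert k a (upd (fun i => aA (b i) w`_i.+2) (inord i) (aA (b (inord i)) z)))).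
    apply/funext => z; rewrite /G !nth_set_nth /=; congr (g _ (insert _ _ _)).
    apply/funext => j; rewrite nth_set_nth /= !eqSS /upd -val_eqE /= inordK; last lia.
    by case: eqP => // <-; rewrite inord_val.
  exact: (lin_comp (g2 _ _ _) (act_linr aA _)).
Qed.

(** Equivariance of [g] on the longer family involves one more leg, the one acting on [a]. By
    invariance of [a] it is a counit and can be erased. *)
Lemma htpy_in_C n (g : cochain A n.+1) : in_C aA g -> in_C aA (htpy g).
Proof.
move=> [gf ge]; split; first exact: htpy_functional.
move=> x y b; rewrite /htpy exchange_big mulr_sumr; apply: eq_big_nat => i hi.
rewrite -scaler_sumr -[RHS]/(_ * (_ * _)) mulrCA; congr (_ * _); rewrite -ge.
have hi1 : (i < n.+1)%N by lia.
(* The first two legs act on [y], so the entry at position [i.+1] receives leg [i.+3]. *)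
rewrite -[LHS](@sum_sweedler_counit _ _ hH _ n.+2 i.+3 x (G g y b i.+1)); first last.
- exact: G_linear.
- lia.
apply: eq_bigr => w _.
pose b' j := aA (b j) w`_(bump i.+3 j.+2).
pose h v : K^o := g (antipodeV hH w`_0 ** y ** w`_1) (insert i.+1 v b').
have lh : linear h.
  exact: insert_slot_linear.
have -> : G g y b i.+1 (del i.+3 w) = h a.
  rewrite /G !nth_del; congr (g _ (insert _ _ _)).
  by apply/funext => j; rewrite nth_del.
rewrite -(lin_scale lh) /h -a_inv; congr (g _ _).
apply/funext => j; have hj := ltn_ord j; rewrite /insert /b' /bump.
by ordcase; congr (aA _ w`_ _); lia.
Qed.

Lemma cyc_of_lam n (g : cochain A n) : lam aA g = g ->
  forall x b, cyc aA g x b = (-1) ^+ n * g x b :> K.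
Proof.
move=> hg x b; rewrite -[in RHS]hg.
rewrite -[lam _ _ _ _]/((-1) ^+ n * cyc aA g x b) mulrA -exprD addnn -mul2n.
by rewrite exprM sqrrN !expr1n mul1r.
Qed.

Lemma sum_inv_arg n (g : cochain A n) x (c : A -> 'I_n.+1 -> A) :
  is_functional g -> (forall y, linear (fun v => g y (c v) : K^o)) ->
  \sum_(w <- sweedler hH 1 x) g w`_0 (c (aA a w`_1)) = g x (c a).
Proof.
move=> [g1 _] gc; rewrite -(lin_counitr hH x (g1 (c a))) -sum_sweedler1.
by apply: eq_bigr => w _; rewrite a_inv (lin_scale (gc _)).
Qed.

(** Rotation lowers every insertion position by one. The only mismatch, position $0$ against
    position $n+1$, is settled in [wrap] by cyclicity of [g] and invariance of [a]. *)
Lemma htpy_lam n (g : cochain A n.+1) :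
  in_Clam aA g -> lam aA (htpy g) = htpy g.
Proof.
move=> [[gf _] glam]; apply/funext => x; apply/funext => b.
have cg := cyc_of_lam glam.
have sgn2 m : (-1) ^+ m * (-1) ^+ m = 1 :> K.
  by rewrite -exprD addnn -mul2n exprM sqrrN !expr1n.
have wrap : g x (insert 0 a b) = (-1) ^+ n.+1 * g x (insert n.+1 a b) :> K.
  rewrite -cg /cyc; under eq_bigr do rewrite rotate_insert_last.
  rewrite (sum_inv_arg x (c := fun v => insert 0 v b) gf) // => y.
  exact: insert_slot_linear.
transitivity (- \sum_(0 <= i < n.+1) (-1) ^+ i * g x (insert i a b) : K).
  rewrite -[LHS]/((-1) ^+ n * _) /cyc /htpy exchange_big /= mulr_sumr -sumrN.
  apply: eq_big_nat => i hi; rewrite -scaler_sumr.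
  transitivity ((-1) ^+ n * ((-1) ^+ i * cyc aA g x (insert i a b)) : K).
    congr (_ * (_ * _)); apply: eq_bigr => w _; rewrite insert_rotate //; lia.
  have move_sign (u v t : K) : u * u = 1 -> u * (v * (-1 * u * t)) = - (v * t).
    by move=> uu; transitivity (- (u * u * (v * t))); [ring | rewrite uu mul1r].
  by rewrite cg exprS; apply: move_sign.
rewrite /htpy big_nat_recl // [RHS]big_nat_recr //= expr0 mul1r wrap opprD.
rewrite addrC; congr (_ + _); first by rewrite exprS mulN1r mulNr opprK.
rewrite -sumrN; apply: eq_bigr => i _.
by rewrite exprS mulN1r mulNr opprK.
Qed.

(** Faces merging two original arguments commute with the insertion up to an index shift, so the
    terms [Q] of the two composites cancel, and so do the last faces [C]. The faces merging [a] with
    a neighbour survive: [r] with the argument on its left, [s] with the one on its right. *)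
Lemma htpy_hochb n (g : cochain A n.+1) : is_functional g ->
  htpy (hochb aA g) + hochb aA (htpy g) = inner g.
Proof.
move=> gf; apply/funext => x; apply/funext => b.
rewrite -[LHS]/(htpy (hochb aA g) x b + hochb aA (htpy g) x b).
pose Q j i : K := g x (insert i.+1 a (merge j b)).
pose r i : K := g x (upd b (inord i) (b (inord i) ** a)).
pose s i : K := g x (upd b (inord i) (a ** b (inord i))).
pose C i : K := dface aA n.+1 (fun x b => g x (insert i.+1 a b)) x b.
have mrg i j : (i <= n.+1)%N -> (j <= n.+1)%N ->
    g x (merge j (insert i.+1 a b)) =
    if (j < i)%N then Q j i.-1 else if j == i then r i
    else if j == i.+1 then s j else Q j.-1 i.
  move=> hi hj; case: ltngtP => hji.
  - case: i hi hji => // i hi hji.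
    by rewrite merge_insert_lt //; lia.
  - case: eqP => [->|hji'].
      by rewrite merge_insert_eqS //; lia.
    by case: j hj hji hji' => // j hj hji hji'; rewrite merge_insert_gt //; lia.
  - rewrite hji (_ : i = (inord i : 'I_n.+2)) ?merge_insert_eq /r ?inordK //.
have last1 i : (i <= n)%N -> dface aA n.+2 g x (insert i.+1 a b) = C i.
  move=> hi; rewrite /C /dface !ltnn; apply: eq_bigr => w _.
  by rewrite merge0_rotate_insert.
(* The telescoped sum lacks $s_0$. It comes from [a] at the very end, which the last face rotates in
   front of argument $0$. *)
have last2 : dface aA n.+2 g x (insert n.+2 a b) = s 0%N.
  have [ml _] := @umul_bilin _ A.
  rewrite /dface ltnn /cyc; under eq_bigr do rewrite merge0_rotate_insert_last.
  rewrite (sum_inv_arg x (c := fun v => upd b ord0 (v ** b ord0)) gf).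
    by rewrite /s; congr (g x (upd b _ (_ ** b _))); apply: val_inj; rewrite /= inordK.
  by move=> y; apply: lin_comp (gf.2 y b ord0) (ml _).
have e1 : htpy (hochb aA g) x b =
   \sum_(0 <= i < n.+2) \sum_(0 <= j < n.+2) (-1) ^+ (i + j) *
     (if (j < i)%N then Q j i.-1 else if j == i then r i
      else if j == i.+1 then s j else Q j.-1 i)
   + (\sum_(0 <= i < n.+1) (-1) ^+ (i + n) * C i - s 0%N).
  rewrite /htpy.
  transitivity (\sum_(0 <= i < n.+2)
     (\sum_(0 <= j < n.+2) (-1) ^+ (i + j) *
       (if (j < i)%N then Q j i.-1 else if j == i then r i
        else if j == i.+1 then s j else Q j.-1 i)
     + (-1) ^+ (i + n) * (if i == n.+1 then s 0%N else C i))).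
    apply: eq_big_nat => i hi; rewrite hochbE big_nat_recr //= [_ *: _]mulrDr; congr (_ + _).
      rewrite mulr_sumr; apply: eq_big_nat => j hj.
      by rewrite mulrA -exprD /dface ifT ?mrg //; lia.
    rewrite mulrA -exprD !addnS !exprS !mulN1r opprK; congr (_ * _).
    by case: eqP => [->|h]; rewrite ?last2 // last1 //; lia.
  rewrite big_split /=; congr (_ + _); rewrite big_nat_recr //= eqxx.
  rewrite addSn exprS addnn -mul2n exprM sqrrN !expr1n mulr1 mulN1r; congr (_ - _).
  by apply: eq_big_nat => i hi; rewrite ifF //; apply/eqP; lia.
have e2 : hochb aA (htpy g) x b =
   \sum_(0 <= i < n.+1) \sum_(0 <= j < n.+1) (-1) ^+ (i + j) * Q j i
   - \sum_(0 <= i < n.+1) (-1) ^+ (i + n) * C i.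
  rewrite hochbE big_nat_recr //=; congr (_ + _).
    rewrite [RHS]exchange_big; apply: eq_big_nat => j hj.
    rewrite /dface ifT; last lia.
    rewrite mulr_sumr; apply: eq_big_nat => i hi.
    by rewrite mulrA -exprD addnC.
  rewrite /dface ltnn /cyc /htpy exchange_big mulr_sumr -sumrN.
  apply: eq_big_nat => i hi; rewrite /C /dface ltnn /cyc.
  by rewrite -scaler_sumr mulrA -exprD addSn exprS mulN1r mulNr addnC.
rewrite e1 e2 alternating_telescope.
have -> : inner g x b = \sum_(0 <= i < n.+2) (r i - s i).
  by rewrite big_mkord; apply: eq_bigr => i _; rewrite /r /s inord_val.
rewrite sumrB [in RHS](big_nat_recl _ _ s) //=; ring.
Qed.

(** In degree $0$ the homotopy has no term $bh$, and the two faces of [g] directly give the two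
    terms of [inner]. *)
Lemma htpy_hochb0 (g : cochain A 0) : is_functional g ->
  htpy (hochb aA g) = inner g.
Proof.
move=> gf; apply/funext => x; apply/funext => b.
rewrite /htpy big_nat1 expr0 scale1r hochbE big_nat_recr //= big_nat1.
rewrite /inner big_ord1 expr0 mul1r expr1 mulN1r /dface /=; congr (_ - _).
  congr g; apply/funext => j; have hj := ltn_ord j.
  by rewrite mergeE updE /insert (inordE b ord0); ordcase.
have [ml _] := @umul_bilin _ A.
transitivity (\sum_(w <- sweedler hH 1 x) g w`_0 (upd b ord0 (aA a w`_1 ** b ord0))).
  apply: eq_bigr => w _; congr g; apply/funext => j; have hj := ltn_ord j.
  by rewrite mergeE updE !rotateE /insert (inordE b ord0); ordcase.
apply: (sum_inv_arg x (c := fun v => upd b ord0 (v ** b ord0)) gf).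
by move=> y; apply: lin_comp (gf.2 y b ord0) (ml _).
Qed.

End Homotopy.

(** The arguments are expanded one at a time; in [main] the first [k] of them are still
    arbitrary. *)
Lemma multilinear_span_ext (K : fieldType) (V W : lmodType K) n (S : V -> Prop)
    (F G : ('I_n -> V) -> W) : multilinear F -> multilinear G ->
  (forall v, exists2 s : seq V, (forall u, u \in s -> S u) & v = \sum_(u <- s) u) ->
  (forall b, (forall i, S (b i)) -> F b = G b) -> F =1 G.
Proof.
move=> hF hG span hS b.
have main k : (k <= n)%N -> forall b, (forall i : 'I_n, (k <= i)%N -> S (b i)) ->
    F b = G b; last first.
  by apply: (main n) => // i; have := ltn_ord i; lia.
elim: k => [|k IH] hk {}b hb; first by apply: hS => i; apply: hb.
have [s hs e] := span (b (Ordinal hk)).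
have -> : b = upd b (Ordinal hk) (\sum_(u <- s) u).
  by apply/funext => i; rewrite /upd; case: eqP => [->|].
rewrite (lin_sum (hF b _)) (lin_sum (hG b _)).
apply: eq_big_seq => u /hs Su; apply: IH => [|i hi]; first exact: ltnW.
rewrite /upd; case: eqP => // h; apply: hb.
have : nat_of_ord i <> k by move=> h'; apply: h; apply: val_inj.
by lia.
Qed.

(** * Vandermonde systems in characteristic zero *)

Lemma eqr_nat_pchar0 (K : fieldType) m k : [pchar K] =i pred0 ->
  (m%:R == k%:R :> K) = (m == k).
Proof.
move=> /pcharf0P K0; wlog hmk : m k / (m <= k)%N.
  by move=> h; case: (leqP m k) => [/h//|/ltnW/h]; rewrite eq_sym => ->; rewrite eq_sym.
by rewrite eq_sym -subr_eq0 -natrB // K0; lia.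
Qed.

Lemma vandermonde_solve (K : fieldType) N (v : nat -> K) : [pchar K] =i pred0 ->
  (* The nodes will be $1,\dots,N$, distinct and nonzero in characteristic zero. *)
  exists c z : 'I_N -> K, (forall j, z j != 0) /\
    forall k, (k < N)%N -> \sum_j c j * z j ^+ k = v k.
Proof.
move=> K0; pose z : 'rV[K]_N := \row_j (j.+1)%:R.
have zV : Vandermonde N z \in unitmx.
  rewrite unitmxE det_Vandermonde unitfE; apply/prodf_neq0 => i _.
  apply/prodf_neq0 => j hij; rewrite !mxE subr_eq0 eqr_nat_pchar0 //; lia.
pose c := invmx (Vandermonde N z) *m \col_k v k.
exists (fun j => c j 0), (fun j => z 0 j); split=> [j|k hk].
  by rewrite mxE (eqr_nat_pchar0 _ 0 K0).
have /matrixP/(_ (Ordinal hk) 0) := mulKVmx zV (\col_k v k).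
rewrite !mxE /= => <-; apply: eq_bigr => j _.
by rewrite [in RHS]mxE mulrC.
Qed.

(** * Pullback of cochains along equivariant algebra maps *)

Section Pullback.
Variables (K : fieldType) (H : unitalAlgType K) (hH : hopfAlgebra H).
Variables (A B : unitalAlgType K).
Variables (aA : moduleAlgebra hH A) (aB : moduleAlgebra hH B).
Local Notation cochain := (@Defs.cochain K H).

Definition pullback (phi : A -> B) n (f : cochain B n) : cochain A n :=
  fun x b => f x (fun i => phi (b i)).

Variable phi : A -> B.
Hypothesis phi_linear : linear phi.
Hypothesis phiM : {morph phi : x y / x ** y}.
Hypothesis phi_act : forall x h, phi (aA x h) = aB (phi x) h.

Lemma pullback_functional n (f : cochain B n) :
  is_functional f -> is_functional (pullback phi f).
Proof.
move=> [f1 f2]; split=> [b|x b k a u v]; first exact: f1.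
by rewrite /pullback !(map_upd (fun=> phi)) phi_linear; apply: f2.
Qed.

Lemma pullback_cyclic : cyclicMorphism aB aA (@pullback phi).
Proof.
have cycE n (f : cochain B n) : cyc aA (pullback phi f) = pullback phi (cyc aB f).
  apply/funext=> x; apply/funext=> b; apply: eq_bigr=> w _.
  congr (f _ _); apply/funext => i; rewrite /rotate.
  by case: eqP => // _; apply: phi_act.
have mE n k (f : cochain B n) :
    (fun x b => pullback phi f x (merge k b)) = pullback phi (fun x b => f x (merge k b)).
  apply/funext=> x; apply/funext=> b; congr (f _ _); apply/funext => i.
  by rewrite /merge; case: ltnP => // _; case: eqP.
split=> [n|n f [ff fe]|n f _|n i f hi _] //.
- split; first exact: pullback_functional.
  move=> x y b; rewrite -fe; apply: eq_bigr=> w _; congr (f _ _).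
  by apply/funext=> i; apply: phi_act.
- by rewrite /dface mE; case: leqP => h //; rewrite -cycE -mE.
Qed.
End Pullback.

(** * Conjugation by the torus of an invariant idempotent *)

Section Conjugation.
Variables (K : fieldType) (H : unitalAlgType K) (hH : hopfAlgebra H).
Variables (A : unitalAlgType K) (aA : moduleAlgebra hH A) (e : A).
Hypothesis K0 : [pchar K] =i pred0.
Hypothesis e_idem : e ** e = e.
Hypothesis e_inv : forall h, aA e h = counit hH h *: e.
Local Notation cochain := (@Defs.cochain K H).

Let ml := (@umul_bilin _ A).1.
Let mr := (@umul_bilin _ A).2.
Let mDl x y z : (x + y) ** z = x ** z + y ** z := bilinDl (@umul_bilin _ A) x y z.
Let mDr x y z : x ** (y + z) = x ** y + x ** z := bilinDr (@umul_bilin _ A) x y z.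
Let mZl c x y : (c *: x) ** y = c *: (x ** y) := bilinZl (@umul_bilin _ A) c x y.
Let mZr c x y : x ** (c *: y) = c *: (x ** y) := bilinZr (@umul_bilin _ A) c x y.

(** Left multiplication by it is $z$ on $eA$ and $1$ on $(1-e)A$; at $z=-1$ it is the involution
    $1-2e$. *)
Definition torus (z : K) : A := uone + (z - 1) *: e.
Definition conj (z : K) (x : A) : A := torus z ** x ** torus z^-1.

Lemma torusV z : z != 0 -> torus z ** torus z^-1 = uone.
Proof.
move=> z0; rewrite /torus mDl !mDr !umul1l umul1r mZl mZr e_idem scalerA -addrA -!scalerDl.
have -> : z^-1 - 1 + (z - 1 + (z - 1) * (z^-1 - 1)) = 0 by field.
by rewrite scale0r addr0.
Qed.

Lemma conjM z : z != 0 -> {morph conj z : x y / x ** y}.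
Proof.
move=> z0 x y; have vt : torus z^-1 ** torus z = uone.
  by rewrite -{2}(invrK z) torusV // invr_eq0.
by rewrite /conj -!umulA [torus z^-1 ** (torus z ** _)]umulA vt umul1l.
Qed.

Lemma conj_linear z : linear (conj z).
Proof. by apply: lin_comp (ml _) (mr _). Qed.

Lemma torus_inv z h : aA (torus z) h = counit hH h *: torus z.
Proof.
rewrite /torus addrC (act_linl aA h) mact_one e_inv scalerDr.
by rewrite !scalerA mulrC.
Qed.

(** The leg acting on [u] becomes a counit, which the counit law erases. *)
Lemma inv_mulr u x h : aA u =1 (fun h => counit hH h *: u) ->
  aA (u ** x) h = u ** aA x h.
Proof.
move=> hu; rewrite mact_mul -(lin_counitl hH h (lin_comp (mr u) (act_linr aA x))).
by rewrite -sum_sweedler1; apply: eq_bigr => w _; rewrite hu mZl.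
Qed.

Lemma inv_mull u x h : aA u =1 (fun h => counit hH h *: u) ->
  aA (x ** u) h = aA x h ** u.
Proof.
move=> hu; rewrite mact_mul -(lin_counitr hH h (lin_comp (ml u) (act_linr aA x))).
by rewrite -sum_sweedler1; apply: eq_bigr => w _; rewrite hu mZr.
Qed.

Lemma conj_act z x h : conj z (aA x h) = aA (conj z x) h.
Proof.
rewrite /conj inv_mull ?inv_mulr //; exact: torus_inv.
Qed.

Lemma conj_cyclic z : z != 0 ->
  cyclicMorphism aA aA (@pullback K H A A (conj z)).
Proof.
move=> z0; apply: pullback_cyclic; [exact: conj_linear | exact: conjM | exact: conj_act].
Qed.

Definition peirce (l r : bool) (x : A) :=
  e ** x = l%:R *: x /\ x ** e = r%:R *: x.

Lemma peirce_span v : exists2 s : seq A,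
  (forall u, u \in s -> exists l r, peirce l r u) & v = \sum_(u <- s) u.
Proof.
pose f : A := uone - e.
have ef : e ** f = 0 by rewrite /f mDr umul1r -scaleN1r mZr e_idem scaleN1r subrr.
have fe : f ** e = 0 by rewrite /f mDl umul1l -scaleN1r mZl e_idem scaleN1r subrr.
have m0 x : x ** 0 = 0 := bilin0r (@umul_bilin _ A) x.
have m0' x : 0 ** x = 0 := bilin0l (@umul_bilin _ A) x.
exists [:: e ** v ** e; e ** v ** f; f ** v ** e; f ** v ** f].
  move=> u; rewrite !inE => /or4P[] /eqP ->.
  - exists true, true; split; first by rewrite !umulA e_idem scale1r.
    by rewrite -!umulA e_idem scale1r.
  - exists true, false; split; first by rewrite !umulA e_idem scale1r.
    by rewrite -!umulA fe !m0 scale0r.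
  - exists false, true; split; first by rewrite !umulA ef !m0' scale0r.
    by rewrite -!umulA e_idem scale1r.
  - exists false, false; split; first by rewrite !umulA ef !m0' scale0r.
    by rewrite -!umulA fe !m0 scale0r.
have ef1 : e + f = uone by rewrite /f addrC subrK.
by rewrite !big_cons big_nil addr0 -mDr addrA -mDr ef1 !umul1r -mDl ef1 umul1l.
Qed.

(** The scalar is $z^{l-r}$, written as $z^{l+(1-r)}/z$ to keep exponents natural for the
    Vandermonde system. *)
Lemma conj_peirce z l r x : z != 0 -> peirce l r x ->
  conj z x = (z ^+ (l + ~~ r) / z) *: x.
Proof.
move=> z0 [hl hr]; rewrite /conj /torus mDl umul1l mZl hl mDr umul1r mZr mDl mZl hr.
rewrite mZl hr !(scalerDr, scalerA) -!addrA -{1}[x]scale1r -!scalerDl; congr (_ *: _).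
case: l r {hl hr} => [] [] /=; rewrite ?expr0 ?expr1 ?addn1 ?addn0; by field.
Qed.

Lemma functional_scale n (f : cochain A n) x b i c : is_functional f ->
  f x (upd b i (c *: b i)) = c * f x b.
Proof.
move=> [_ f2]; rewrite (lin_scale (f2 x b i)); congr (_ * f _ _).
by apply/funext => j; rewrite /upd; case: eqP => [->|].
Qed.

Lemma functional_scale_all n (f : cochain A n) x b (c : 'I_n.+1 -> K) :
  is_functional f ->
  f x (fun i => c i *: b i) = (\prod_i c i) * f x b.
Proof.
move=> ff.
have key (s : seq 'I_n.+1) : uniq s ->
   f x (fun i => (if i \in s then c i else 1) *: b i) = \prod_(i <- s) c i * f x b.
  elim: s => [|k s IH] /=.
    by rewrite big_nil mul1r => _; congr (f _ _); apply/funext => i; rewrite scale1r.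
  move=> /andP[ks us]; rewrite big_cons -mulrA -IH // -(functional_scale _ _ k _ ff).
  congr (f _ _); apply/funext => i; rewrite inE /upd.
  by case: eqP => [->|] //=; rewrite (negbTE ks) scale1r.
rewrite -(key _ (index_enum_uniq _)); congr (f _ _).
by apply/funext => i; rewrite mem_index_enum.
Qed.

Lemma inner_multilinear n (f : cochain A n) x :
  is_functional f -> multilinear (inner e f x).
Proof.
move=> [_ f2] b k; apply: linear_bigsum => i.
have sub (F G : A -> K^o) : linear F -> linear G -> linear (fun y => F y - G y).
  by move=> lF lG c u v; rewrite lF lG opprD scalerBr addrACA.
(* Either the varied slot is the one multiplied by [e], or the two updates concern different slots
   and commute. *)
apply: (sub); case: (eqVneq i k) => [->|hik].
- have -> : (fun y => f x (upd (upd b k y) k (upd b k y k ** e)))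
      = (fun y => f x (upd b k (y ** e))).
    apply/funext => y; congr (f x _); apply/funext => j; rewrite /upd eqxx.
    by case: eqP.
  exact: (lin_comp (f2 x b k) (ml e)).
- have -> : (fun y => f x (upd (upd b k y) i (upd b k y i ** e)))
      = (fun y => f x (upd (upd b i (b i ** e)) k y)).
    apply/funext => y; congr (f x _); apply/funext => j; rewrite /upd (negbTE hik).
    by case: (eqVneq j i) => [->|] //; rewrite (negbTE hik).
  exact: f2.
- have -> : (fun y => f x (upd (upd b k y) k (e ** upd b k y k)))
      = (fun y => f x (upd b k (e ** y))).
    apply/funext => y; congr (f x _); apply/funext => j; rewrite /upd eqxx.
    by case: eqP.
  exact: (lin_comp (f2 x b k) (mr e)).
- have -> : (fun y => f x (upd (upd b k y) i (e ** upd b k y i)))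
      = (fun y => f x (upd (upd b i (e ** b i)) k y)).
    apply/funext => y; congr (f x _); apply/funext => j; rewrite /upd (negbTE hik).
    by case: (eqVneq j i) => [->|] //; rewrite (negbTE hik).
  exact: f2.
Qed.

Section Homogeneous.
Variables (n : nat) (b : 'I_n.+1 -> A) (l r : 'I_n.+1 -> bool).
Hypothesis hb : forall i, peirce (l i) (r i) (b i).

(** The degree $\sum_i(l_i-r_i)$ shifted by $n+1$, hence a natural number between $0$ and
    $2(n+1)$. *)
Let wt := (\sum_i (l i + ~~ r i))%N.

Lemma pullback_conj_peirce z (f : cochain A n) x : z != 0 -> is_functional f ->
  pullback (conj z) f x b = z ^+ wt / z ^+ n.+1 * f x b :> K.
Proof.
move=> z0 ff; rewrite /pullback; under [X in f x X]funext do rewrite (conj_peirce z0 (hb _)).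
rewrite functional_scale_all //; congr (_ * _).
by rewrite big_split /= prodrXr prodr_const card_ord exprVn.
Qed.

Lemma inner_peirce (f : cochain A n) x : is_functional f ->
  inner e f x b = (n.+1%:R - wt%:R) * f x b :> K.
Proof.
move=> ff; rewrite /inner.
transitivity (\sum_(i < n.+1) (1 - (l i + ~~ r i)%:R) * f x b : K).
  apply: eq_bigr => i _; have [-> ->] := hb i.
  rewrite !functional_scale // -mulrBl; congr (_ * _).
  by case: (l i); case: (r i); rewrite /= ?addn0 ?addn1; ring.
by rewrite -mulr_suml sumrB sumr_const card_ord natr_sum.
Qed.
End Homogeneous.

Lemma conj_sign_cohomologous n (f : cochain A n) : f \in @cocycle K H hH A aA n ->
  pullback (conj (-1)) f - f \in @coboundary K H hH A aA n.
Proof.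
move=> fZ.
have N1 : (-1 : K) != 0 by rewrite oppr_eq0 oner_eq0.
(* v W is the factor needed on tensors of weight W; at W = n + 1 it is 0 / 0 = 0. *)
pose v W : K := ((-1) ^+ W / (-1) ^+ n.+1 - 1) / (n.+1%:R - W%:R).
(* There are $2(n+1)+1$ possible weights. *)
have [c [z [z0 hc]]] := vandermonde_solve (n.+1).*2.+1 v K0.
(* The factor $z_j^{n+1}$ clears the denominator in [pullback_conj_peirce], so [f'] is [v W] times
   [f] on tensors of weight [W]. *)
pose f' : cochain A n := \sum_j (c j * z j ^+ n.+1) *: pullback (conj (z j)) f.
have f'Z : f' \in @cocycle K H hH A aA n.
  apply: rpred_sum => j _; apply: rpredZ.
  exact: (cyclic_cocycle (conj_cyclic (z0 j)) fZ).
have /asboolP[[[ff _] _] _] := fZ.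
have /asboolP[fC fb] := f'Z; have f'f := fC.1.1.
have -> : pullback (conj (-1)) f - f = inner e f'.
  apply/funext => x; apply/funext.
  have pf := pullback_functional (conj_linear (-1)) ff.
  apply: (multilinear_span_ext (S := fun u => exists l r, peirce l r u)).
  - rewrite addrC -scaleN1r; exact: (is_functional_closed (-1) ff pf).2.
  - exact: inner_multilinear.
  - exact: peirce_span.
  move=> b /choice[l] /choice[r] hb; rewrite (inner_peirce hb) //.
  rewrite -[LHS]/(pullback (conj (-1)) f x b - f x b : K) (pullback_conj_peirce hb) //.
  set W := (\sum_i _)%N.
  have hW : (W < (n.+1).*2.+1)%N.
    rewrite ltnS -muln2 mulnC -[X in (_ * X)%N]card_ord mulnC -sum_nat_const.
    apply: leq_sum => i _.
    by case: (l i); case: (r i).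
  have -> : f' x b = v W * f x b.
    rewrite /f' -(hc _ hW) mulr_suml.
    have lev : linear (fun g : cochain A n => g x b : K^o) by [].
    rewrite (lin_sum lev); apply: eq_bigr => j _; rewrite (lin_scale lev).
    rewrite (pullback_conj_peirce hb) // -/W -[LHS]/(_ * _ : K).
    by move: (f x b : K) => t; field; rewrite expf_neq0.
  rewrite /v; case: (eqVneq n.+1 W) => [<-|hne].
    by rewrite subrr mul0r divff ?expf_neq0 // mul1r subrr.
  have d0 : n.+1%:R - W%:R != 0 :> K by rewrite subr_eq0 eqr_nat_pchar0.
  by rewrite mulrA (mulrC (_ - _)) divfK // mulrBl mul1r.
(* As $bf'=0$, the homotopy formula makes [inner e f'] vanish in degree $0$, where zero is the only
   coboundary. In higher degrees it has the primitive [htpy e f']. *)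
case: n f fZ v c z z0 hc f' f'Z ff fC fb f'f => [|m] f fZ v c z z0 hc f' f'Z ff fC fb f'f.
  by apply/asboolP; rewrite -(htpy_hochb0 e_inv f'f) fb htpy0.
apply/asboolP; exists (htpy e f').
  by split; [apply: htpy_in_C fC.1 | apply: htpy_lam].
by rewrite -(htpy_hochb e_inv f'f) fb htpy0 add0r.
Qed.

End Conjugation.

(** * Matrix units and the trace of a rank-one idempotent *)

Section MatrixUnits.
Variables (K : fieldType) (X : vectType K).
Local Notation N := (\dim {:X}).
Let bX := vbasisP {:X}.
Let hom_lin := @passmx.hommx_linear K X X (vbasis {:X}) (vbasis {:X}).

(** The indices are transposed because matrices act on row vectors, which reverses products under
    composition. *)
Definition unit_endo (i j : 'I_N) : endo X :=
  passmx.hommx (vbasis {:X}) (vbasis {:X}) (delta_mx j i).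

Lemma unit_endoM i j k l :
  unit_endo i j ** unit_endo k l = if j == k then unit_endo i l else 0.
Proof.
rewrite /unit_endo -[LHS](passmx.hommx_mul bX bX bX) mul_delta_mx_cond eq_sym.
by case: eqP => _; rewrite ?mulr1n // mulr0n (linear0' hom_lin).
Qed.

Lemma unit_endo_sum (T : endo X) :
  T = \sum_i \sum_j passmx.mxof (vbasis {:X}) (vbasis {:X}) T j i *: unit_endo i j.
Proof.
rewrite exchange_big -{1}[T](passmx.mxofK bX bX).
rewrite {1}[passmx.mxof _ _ _]matrix_sum_delta (lin_sum hom_lin).
apply: eq_bigr => j _; rewrite (lin_sum hom_lin); apply: eq_bigr => i _.
by rewrite (lin_scale hom_lin).
Qed.

Lemma unit_endo1 : \sum_i unit_endo i i = uone.
Proof.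
rewrite -[RHS](passmx.hommx1 bX) -(lin_sum hom_lin); congr (passmx.hommx _ _ _).
apply/matrixP => i j; rewrite summxE mxE.
rewrite (bigD1 i) //= mxE eqxx big1 ?addr0 => [|k]; first by rewrite eq_sym.
by rewrite mxE eq_sym => /negPf->.
Qed.

Lemma linear_endo_ext (W : lmodType K) (f g : endo X -> W) : linear f -> linear g ->
  (forall i j, f (unit_endo i j) = g (unit_endo i j)) -> f =1 g.
Proof.
move=> lf lg h T; rewrite [T]unit_endo_sum !(lin_sum lf, lin_sum lg).
apply: eq_bigr => i _; rewrite !(lin_sum lf, lin_sum lg).
by apply: eq_bigr => j _; rewrite (lin_scale lf) (lin_scale lg) h.
Qed.

(** Write $px=c(x)v$ with $v$ spanning the image. Then $\mathrm{Tr}\,p=c(v)$, and $c(v)=1$ because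
    $pv=v$. *)
Lemma trace_rank1_idempotent (p : endo X) :
  p ** p = p -> \dim (limg p) = 1%N -> trace p = 1.
Proof.
move=> pp d1; pose v := vpick (limg p).
have v0 : v != 0 by rewrite vpick0 -dimv_eq0 d1.
have lp : limg p = <[v]>%VS.
  by apply/esym/eqP; rewrite eqEdim -memvE memv_pick dim_vline v0 d1.
have /all_sig[c hc] x : {k | p x = k *: v}.
  by apply/sig_eqW/vlineP; rewrite -lp memv_img ?memvf.
have pv : p v = v.
  have /memv_imgP[y _ ->] : v \in limg p by apply: memv_pick.
  by rewrite -[in RHS]pp [RHS]comp_lfunE.
(* The function [c] is merely chosen pointwise; its expansion in the basis is obtained after
   multiplication by [v], which is nonzero. *)
have cE x : c x *: v = \sum_i (coord (vbasis {:X}) i x * c (vbasis {:X})`_i) *: v.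
  rewrite -hc {1}[x](coord_basis bX (memvf x)) linear_sum; apply: eq_bigr => i _.
  by rewrite linearZ /= hc scalerA.
have c1 : \sum_i coord (vbasis {:X}) i v * c (vbasis {:X})`_i = 1.
  apply/eqP; rewrite -subr_eq0 -(orbF (_ == 0)) -(negbTE v0) -scaler_eq0.
  by rewrite scalerBl scale1r scaler_suml -cE -hc pv subrr.
rewrite -c1 /trace /mxtrace; apply: eq_bigr => i _.
by rewrite !mxE /= passmx.vecof_delta hc linearZ /= mulrC.
Qed.
End MatrixUnits.

(** * The flip of two copies of $\mathrm{End}(X)$ *)

Section Flip.
Variables (K : fieldType) (X : vectType K) (B : unitalAlgType K).
Local Notation N := (\dim {:X}).
Local Notation E := (tensor (endo X) B).
Local Notation EE := (tensor (endo X) E).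

Definition flip : EE :=
  \sum_i \sum_j unit_endo i j \ox (unit_endo j i \ox (uone : B)).

Lemma tensorM (A C : unitalAlgType K) (a a' : A) (c c' : C) :
  (a \ox c) ** (a' \ox c') = (a ** a') \ox (c ** c').
Proof. exact: tmul_pair. Qed.

Lemma flip_mul (k l m n : 'I_N) (b : B) :
  flip ** (unit_endo k l \ox (unit_endo m n \ox b))
  = unit_endo m l \ox (unit_endo k n \ox b).
Proof.
have [ml mr] := @umul_bilin _ EE.
rewrite /flip (lin_sum (ml _)) (bigD1 m) //= (lin_sum (ml _)) (bigD1 k) //=.
have e i j : (unit_endo i j \ox (unit_endo j i \ox (uone : B)))
      ** (unit_endo k l \ox (unit_endo m n \ox b))
  = if (j == k) && (i == m) then unit_endo m l \ox (unit_endo k n \ox b) else 0.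
  rewrite !tensorM umul1l !unit_endoM.
  case: eqP => [->|_] /=; last by rewrite (bilin0l (@tpair_bilin _ _ _)).
  case: eqP => [->|_] //=.
  by rewrite (bilin0l (@tpair_bilin _ _ _)) (bilin0r (@tpair_bilin _ _ _)).
rewrite e !eqxx /= !big1 ?addr0 // => [i hi|j hj].
  by rewrite (lin_sum (ml _)) big1 // => j _; rewrite e (negPf hi) andbF.
by rewrite e (negPf hj).
Qed.

Lemma mul_flip (k l m n : 'I_N) (b : B) :
  (unit_endo k l \ox (unit_endo m n \ox b)) ** flip
  = unit_endo k n \ox (unit_endo m l \ox b).
Proof.
have [ml mr] := @umul_bilin _ EE.
rewrite /flip (lin_sum (mr _)) (bigD1 l) //= (lin_sum (mr _)) (bigD1 n) //=.
have e i j : (unit_endo k l \ox (unit_endo m n \ox b))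
      ** (unit_endo i j \ox (unit_endo j i \ox (uone : B)))
  = if (l == i) && (n == j) then unit_endo k n \ox (unit_endo m l \ox b) else 0.
  rewrite !tensorM umul1r !unit_endoM.
  case: eqP => [->|_] /=; last by rewrite (bilin0l (@tpair_bilin _ _ _)).
  case: eqP => [->|_] //=.
  by rewrite (bilin0l (@tpair_bilin _ _ _)) (bilin0r (@tpair_bilin _ _ _)).
rewrite e !eqxx /= !big1 ?addr0 // => [i hi|j hj].
  by rewrite (lin_sum (mr _)) big1 // => j _; rewrite e eq_sym (negPf hi).
by rewrite e [n == j]eq_sym (negPf hj) andbF.
Qed.

(** Both sides are bilinear in [S] and [T], so matrix units suffice. *)
Lemma flipC (S T : endo X) (b : B) :
  flip ** (S \ox (T \ox b)) = (T \ox (S \ox b)) ** flip.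
Proof.
have [ml mr] := @umul_bilin _ EE.
have [tl tr] := @tpair_bilin _ (endo X) E.
have [ul ur] := @tpair_bilin _ (endo X) B.
move: S; apply: linear_endo_ext.
- exact: lin_comp (mr _) (tl _).
- exact: lin_comp (ml _) (lin_comp (tr _) (ul _)).
move=> k l; move: T; apply: linear_endo_ext.
- exact: lin_comp (mr _) (lin_comp (tr _) (ul _)).
- exact: lin_comp (ml _) (tl _).
by move=> m n; rewrite flip_mul mul_flip.
Qed.

Lemma flip_invol : flip ** flip = uone.
Proof.
have [ml mr] := @umul_bilin _ EE.
have [tl tr] := @tpair_bilin _ (endo X) E.
have [ul ur] := @tpair_bilin _ (endo X) B.
rewrite {2}/flip (lin_sum (mr _)).
transitivity (\sum_i \sum_j unit_endo j j \ox (unit_endo i i \ox (uone : B)) : EE).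
  by apply: eq_bigr => i _; rewrite (lin_sum (mr _)); apply: eq_bigr => j _; rewrite flip_mul.
rewrite exchange_big -[RHS]/(uone \ox (uone \ox uone)) -unit_endo1 (lin_sum (tl _)).
apply: eq_bigr => j _; rewrite (lin_sum (ul _)) (lin_sum (tr _)).
by [].
Qed.

End Flip.

(** * The two composites on cohomology *)

Section Main.
Variables (K : fieldType) (H : unitalAlgType K) (hH : hopfAlgebra H).
Variables (X : vectType K) (B : unitalAlgType K) (act : moduleAlgebra hH B).
Hypothesis K0 : [pchar K] =i pred0.
Variable p : endo X.
Hypothesis p_idem : p ** p = p.
Hypothesis p_rank1 : \dim (limg p) = 1%N.
Local Notation E := (tensor (endo X) B).
Local Notation EE := (tensor (endo X) E).
Local Notation eact := (endT_trivial X act).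
Local Notation eeact := (endT_trivial X eact).
Local Notation cochain := (@Defs.cochain K H).

Lemma trace_prod_idem n : trace (\big[umul/uone]_(i < n.+1) p) = 1.
Proof.
elim: n => [|n IH]; first by rewrite big_ord1 trace_rank1_idempotent.
move: IH; rewrite !big_ord_recl /= => IH.
by rewrite umulA p_idem.
Qed.

(** This holds on cochains, as $\mathrm{Tr}(p^{n+1})=\mathrm{Tr}\,p=1$. The algebra [C] is general
    because both $\mathcal B$ and $\mathrm{End}(X)\otimes\mathcal B$ occur. *)
Lemma Phi_Psi (C : unitalAlgType K) n (f : cochain C n) : is_functional f ->
  Phi p (Psi hH (trivModule hH X) f) = f.
Proof.
move=> ff; apply/funext => x; apply/funext => b.
by rewrite /Phi Psi_pure // trace_prod_idem mulr1.
Qed.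

Lemma flip_inv h : eeact (flip X B) h = counit hH h *: flip X B.
Proof.
rewrite /flip (lin_sum (act_linl eeact h)) scaler_sumr; apply: eq_bigr => i _.
rewrite (lin_sum (act_linl eeact h)) scaler_sumr; apply: eq_bigr => j _.
transitivity (unit_endo i j \ox eact (unit_endo j i \ox uone) h); first exact: endT_pair.
rewrite [eact _ h]endT_pair mact_one.
by rewrite (lin_scale ((@tpair_bilin _ _ _).2 _)) (lin_scale ((@tpair_bilin _ _ _).2 _)).
Qed.

(** The projection onto antisymmetric tensors, so that $1-2e$ is the flip. *)
Let e : EE := 2%:R^-1 *: (uone - flip X B).

Let two0 : 2%:R != 0 :> K.
Proof. by rewrite (eqr_nat_pchar0 2 0 K0). Qed.

Lemma e_idem : e ** e = e.
Proof.
have mb := @umul_bilin _ EE.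
have sq : (uone - flip X B) ** (uone - flip X B) = 2%:R *: (uone - flip X B).
  rewrite -scaleN1r !(bilinDl mb, bilinDr mb) !(bilinZl mb, bilinZr mb) !umul1l !umul1r.
  by rewrite flip_invol scalerA mulrNN mulr1 scale1r [-1 *: _ + _]addrC -mulr2n scaler_nat.
by rewrite /e (bilinZl mb) (bilinZr mb) sq scalerA scalerA -mulrA mulVf // mulr1.
Qed.

Lemma e_inv h : eeact e h = counit hH h *: e.
Proof.
rewrite /e (lin_scale (act_linl eeact h)) addrC -scaleN1r (act_linl eeact h).
by rewrite flip_inv mact_one !scalerDr !scalerA; congr (_ *: _ + _ *: _); ring.
Qed.

Lemma torus_flip : torus e (-1) = flip X B.
Proof.
rewrite /torus /e scalerA.
have -> : (-1 - 1) / 2%:R = -1 :> K by field.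
by rewrite scaleN1r opprB addrC subrK.
Qed.

Lemma conj_flip (S T : endo X) (b : B) :
  conj e (-1) (S \ox (T \ox b)) = T \ox (S \ox b).
Proof.
by rewrite /conj invrN1 torus_flip flipC -umulA flip_invol umul1r.
Qed.

Lemma Psi_Phi n (f : cochain E n) : f \in @cocycle K H hH E eact n ->
  Psi hH (trivModule hH X) (Phi p f) - f \in @coboundary K H hH E eact n.
Proof.
move=> fZ; have /asboolP[[[ff _] _] _] := fZ.
pose g := Psi hH (trivModule hH X) f.
have gZ : g \in @cocycle K H hH EE eeact n by apply: (cyclic_cocycle (Psi_cyclic X eact)).
have /(cyclic_coboundary (Phi_cyclic eact p_idem)) :=
  conj_sign_cohomologous K0 e_idem e_inv gZ.
have -> : Phi p (pullback (conj e (-1)) g - g)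
  = Phi p (pullback (conj e (-1)) g) - Phi p g by [].
have -> : Phi p g = f by apply: Phi_Psi.
(* Conjugation turns $p\otimes(T_i\otimes b_i)$ into $T_i\otimes(p\otimes b_i)$. Hence [f] sees the
   $p\otimes b_i$ and the trace sees the $T_i$. *)
suff -> : Phi p (pullback (conj e (-1)) g) = Psi hH (trivModule hH X) (Phi p f) by [].
have pf : is_functional (Phi p f).
  by have /asboolP[[[]]] := cyclic_cocycle (Phi_cyclic act p_idem) fZ.
have N1 : (-1 : K) != 0 by rewrite oppr_eq0 oner_eq0.
apply/funext => x; apply/funext; apply: multilinear_ext.
- have /asboolP[[gC _] _] := gZ.
  exact: (cyclic_in_C (Phi_cyclic eact p_idem)
            (cyclic_in_C (conj_cyclic e_idem e_inv N1) gC)).1.2.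
- exact: (Psi_functional hH X pf).2.
move=> T b; rewrite Psi_pure // /Phi /pullback.
under [X in g x X]funext do rewrite conj_flip.
by rewrite /g Psi_pure.
Qed.

Lemma HC_PsiK n : cancel (HC_Psi X act n) (HC_Phi act p_idem n).
Proof.
elim/subq_ind => z; rewrite [HC_Psi _ _ _ _]induced_class [LHS]induced_class.
congr (subq_class _ _); apply: val_inj => /=; apply: Phi_Psi.
by have /asboolP[[[]]] := valP z.
Qed.

Lemma HC_PhiK n : cancel (HC_Phi act p_idem n) (HC_Psi X act n).
Proof.
elim/subq_ind => z; rewrite [HC_Phi _ _ _ _]induced_class [LHS]induced_class.
apply/subq_class_eq => /=; apply: Psi_Phi; exact: valP z.
Qed.

End Main.

Theorem theorem1p3 (R : realType)
    (H : unitalAlgType R[i]) (hH : hopfAlgebra H)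
    (B : unitalAlgType R[i]) (act : moduleAlgebra hH B)
    (X : vectType R[i]) (n : nat) :
  ((0 < \dim {:X})%N -> bijective (HC_Psi X act n)) /\
  (forall (p : endo X) (p_idem : p ** p = p), \dim (limg p) = 1%N ->
     cancel (HC_Psi X act n) (HC_Phi act p_idem n) /\
     cancel (HC_Phi act p_idem n) (HC_Psi X act n)).
Proof.
have C0 : [pchar R[i]] =i pred0 by apply: pchar_num.
have inv (p : endo X) (p_idem : p ** p = p) : \dim (limg p) = 1%N ->
     cancel (HC_Psi X act n) (HC_Phi act p_idem n) /\
     cancel (HC_Phi act p_idem n) (HC_Psi X act n).
  by move=> d1; split; [apply: HC_PsiK | apply: HC_PhiK].
(* Bijectivity is asserted without a given [p], so one is supplied: the projection onto the line of
   a nonzero vector of [X]. *)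
split=> // X0; pose p : endo X := projv <[vpick {:X}]>.
have p_idem : p ** p = p by apply/lfunP => x; rewrite [LHS]comp_lfunE projv_proj.
have d1 : \dim (limg p) = 1%N.
  by rewrite limg_proj dim_vline vpick0 -dimv_eq0 -lt0n X0.
by have [PsiK PhiK] := inv p p_idem d1; apply: Bijective PsiK PhiK.
Qed.
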